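(* Let $h\in(0,1/2)$ and $\beta\in(0,1/2)$. Let $0<\lambda\le e^{-c/h}$ with a sufficiently large $c$. There exist points $E_k>0$, $1\le k\le K$, $K=[1/(2h)]$, such that $$E_k=2\cos\bigl(\pi hk+O_H(\lambda^\beta)\bigr),$$ and, if $1\le k\le K-1$, or if $k=K$ and $[1/h]$ is odd, then the point $E_k$ is located inside a gap $g_k$ of the Harper operator. The length of $g_k$ satisfies the estimate $$|g_k|\ge 4\left(\frac\lambda4\right)^{k}\frac{1+O_H(\lambda^\beta)}{\sin^2(\pi h)\,\sin^2(2\pi h)\cdots\sin^2(\pi h(k-1))},$$ where for $k=1$ the product of the sines has to be replaced with one. If $[1/h]$ is even and $\lambda^{h_1}\le e^{-c/h}$, where $h_1=\{1/h\}$, then the point $E_K$ is also located in a gap $g_K$, and the length of $g_K$ satisfies the same estimate (with $k=K$) with $\beta$ replaced by $\min\{h_1,\beta\}$.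
   Context: The Harper operator acts in $L^2(\mathbb R)$ by $H\psi(x)=\psi(x+h)+\psi(x-h)+2\lambda\cos(2\pi x)\psi(x)$. A gap is a connected component of the complement in $\mathbb R$ of its spectrum. $[\cdot]$ is the integer part and $\{\cdot\}$ the fractional part. $f=O_H(g)$ means $|f|\le e^{C/h}|g|$ with a constant $C>0$ independent of $h$, $\lambda$ and $k$. *)

(* Defs.v *)
From mathcomp Require Import all_boot all_order all_algebra.
From mathcomp Require Import all_classical all_reals all_analysis.
From mathcomp Require Import complex.

Set Implicit Arguments.
Unset Strict Implicit.
Unset Printing Implicit Defensive.

Import Order.TTheory GRing.Theory Num.Theory.
Import numFieldNormedType.Exports.

Local Open Scope classical_set_scope.
Local Open Scope ring_scope.
Local Open Scope complex_scope.

(* Elements of L^2(R; C) are handled through representatives R -> R[i], and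
   equality in L^2 is equality almost everywhere. *)
Definition L2 (R : realType) : set (R -> R[i]) :=
  [set psi : R -> R[i] |
    (@complex.Re R \o psi : R -> R) \in Lfun (@lebesgue_measure R) 2%:E /\
    (@complex.Im R \o psi : R -> R) \in Lfun (@lebesgue_measure R) 2%:E].

Definition L2norm (R : realType) (psi : R -> R[i]) : \bar R :=
  'N[@lebesgue_measure R]_2%:E[(fun x : R => (complex.ComplexField.Normc.normc (psi x))%:E)].

Definition L2eq (R : realType) (f g : R -> R[i]) : Prop :=
  ae_eq (@lebesgue_measure R) setT f g.

(* z is in the resolvent set when T - z, as an operator on L^2, has a bounded
   two-sided inverse S.  That S is linear and well defined on a.e.-classes
   follows for the linear operators T considered here: the bound and the last
   clause make T - z injective modulo a.e. equality. *)
Definition resolvent_set (R : realType) (T : (R -> R[i]) -> (R -> R[i])) :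
    set R[i] :=
  [set z | exists S : (R -> R[i]) -> (R -> R[i]),
    [/\ forall f, L2 f -> L2 (S f),
        exists M : R, forall f, L2 f -> (L2norm (S f) <= M%:E * L2norm f)%E,
        forall f, L2 f -> L2eq (fun x => T (S f) x - z * S f x) f
      & forall f, L2 f -> L2eq (S (fun x => T f x - z * f x)) f]].

Definition spectrum (R : realType) (T : (R -> R[i]) -> (R -> R[i])) :
    set R[i] := ~` resolvent_set T.

Definition harper (R : realType) (h lambda : R) (psi : R -> R[i]) :
    R -> R[i] :=
  fun x => psi (x + h) + psi (x - h)
           + (2 * lambda * cos (2 * pi * x))%:C * psi x.

Definition is_gap (R : realType) (h lambda : R) (g : set R) : Prop :=
  let A := [set E : R | ~ spectrum (harper h lambda) E%:C] in
  exists2 E, A E & g = connected_component A E.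

(* f = O_H(g) with constant C *)
Definition OH (R : realType) (C h f g : R) : Prop :=
  `|f| <= expR (C / h) * `|g|.

Definition sin2_prod (R : realType) (h : R) (k : nat) : R :=
  \prod_(1 <= j < k) sin (pi * h * j%:R) ^+ 2.

(* E lies in a gap g satisfying
     |g| >= 4 (lambda/4)^k (1 + O_H(lambda^b)) / sin2_prod h k. *)
Definition in_large_gap (R : realType) (C h lambda b : R) (k : nat) (E : R) :
    Prop :=
  exists g : set R, [/\ is_gap h lambda g, g E &
    exists r : R, OH C h r (lambda `^ b) /\
      ((4 * (lambda / 4) ^+ k * ((1 + r) / sin2_prod h k))%:E
         <= @lebesgue_measure R g)%E].

(* Main.v *)
Require Import Defs.
From mathcomp Require Import all_boot all_order all_algebra.
From mathcomp Require Import all_classical all_reals all_analysis.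
From mathcomp Require Import complex measurable_realfun zify ring lra.

(** Why the theorem is true.

    On each orbit [x + n h] the equation [H psi = E psi] is a second order
    difference equation with the weak potential [2 lam cos].  Fourier
    transformation along the orbit (Aubry duality) turns it into
      [lam (v (m+1) + v (m-1)) + (2 cos (pi (2 h m + th)) - E) v m],
    where the hopping is weak and the diagonal is strong.  Away from the sites
    where the diagonal is nearly zero this operator is inverted by its diagonal.
    For [E] near [2 cos (pi h k)] the exceptional sites are those whose phase is
    within a small [s] of [h k] or [- h k] modulo 2.
    They come in pairs at distance [k], because [k] steps lead from [- h k] to
    [h k], and the [k-1] sites between the partners and the [k] sites beyond
    each of them are not exceptional.

    Eliminating these chains by continued fractions ([chain_elim], [site_elim])
    leaves a two by two system.  Its diagonal entries are the effective
    diagonals [eff_diag] at [s] and [- s]; its off-diagonal entries [tunnel] have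
    size [lam^k] divided by the product of the [k-1] denominators met on the
    way, that is [4 (lam/4)^k / sin2_prod h k] ([half_gapE]).  Choose [E0] so that
    the effective diagonal vanishes at [s = 0] ([gap_center]).  Then the two
    diagonal entries are opposite to first order in [s], so the system is
    uniformly invertible as long as [E - E0] is smaller than the tunnelling term
    ([pair_solve]): an interval around [E0] is free of spectrum.  The gap
    obtained has length about [2 half_gap], twice the bound to be proved.  Using
    only its middle half leaves room for all errors, and the relative error in
    the length can be taken to be zero.

    The local inversion becomes a lower bound in l^2 of the dual lattice
    ([local_to_l2], [dual_coercive]).  Duality and a discrete Parseval identity
    move it to the orbits of [h], the boundary terms of the cut-offs being
    negligible on long intervals ([aubry_duality], [grid_parseval],
    [space_coercive]).  Translation invariance of the Lebesgue measure moves it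
    to [L^2(R)] ([hop_coercive]), and a coercive self-adjoint operator
    is invertible ([hop_solve], [resolvent_of_coercive]).

    All smallness is measured by one parameter [z = exp (- 1/h) (1 - 2 h k)]: the
    denominators are at least powers of [z], and [lam <= z^20].  If [k < K], or if
    [1/h] has odd integer part, then [1 - 2 h k >= h] and a bound
    [lam <= exp (- c/h)] suffices ([wide_small]).  In the remaining case
    [1 - 2 h K = h h1] may be arbitrarily small, and the hypothesis on
    [lam^h1] says that [lam <= exp (- c / (1 - 2 h K))] ([even_small]). *)

Set Implicit Arguments.
Unset Strict Implicit.
Import Order.TTheory GRing.Theory Num.Theory.
Import numFieldNormedType.Exports.
Local Open Scope ring_scope.

(** * Continued fractions *)

(** Solving [lam (v i + v (i+2)) + d i * v (i+1) = 0] for [i < n] gives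
    [v 1 = cfrac * v 0 + cfprod * v (n+1)]: [cfrac] is the reflection coefficient
    of the chain and [cfprod] its transmission coefficient. *)
Fixpoint cfrac {R : fieldType} (lam : R) (d : nat -> R) (n : nat) : R :=
  if n is m.+1 then - lam / (d 0%N + lam * cfrac lam (fun i => d i.+1) m)
  else 0.

Fixpoint cfprod {R : fieldType} (lam : R) (d : nat -> R) (n : nat) : R :=
  if n is m.+1 then cfrac lam d n * cfprod lam (fun i => d i.+1) m else 1.

Lemma cfrac_denom (R : realFieldType) (lam d r : R) : 0 < lam ->
  2 * lam <= `|d| -> `|r| <= 1 ->
  `|d| / 2 <= `|d + lam * r| /\ `|d| - lam <= `|d + lam * r|.
Proof.
move=> l0 ld r1.
have H : `|d| - lam <= `|d + lam * r|.
  have : `|lam * r| <= lam by rewrite normrM gtr0_norm// ler_piMr// ltW.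
  have := lerB_normD d (lam * r).
  by lra.
by split=> //; apply: le_trans H; lra.
Qed.

Lemma cfrac_le1 (R : realFieldType) (lam : R) (n : nat) (d : nat -> R) :
  0 < lam -> (forall i, (i < n)%N -> 2 * lam <= `|d i|) ->
  `|cfrac lam d n| <= 1.
Proof.
move=> l0; elim: n d => [|n IH] d dn /=; first by rewrite normr0.
have r1 : `|cfrac lam (fun i => d i.+1) n| <= 1 by apply: IH => i ?; exact: dn.
have [h1 _] := cfrac_denom l0 (dn 0%N isT) r1.
have d0 := dn 0%N isT.
rewrite normrM normrN normfV (gtr0_norm l0) ler_pdivrMr ?mul1r; lra.
Qed.

(** Eliminating the sites from the far end: each step multiplies the error already
    made by a reflection coefficient, at most one in absolute value. *)
Lemma chain_elim (R : realFieldType) (lam : R) (n : nat) (d v : nat -> R) :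
  0 < lam -> (forall i, (i < n)%N -> 2 * lam <= `|d i|) ->
  `|lam * v 1%N - lam * cfrac lam d n * v 0%N - lam * cfprod lam d n * v n.+1|
    <= \sum_(i < n) `|lam * (v i + v i.+2) + d i * v i.+1|.
Proof.
move=> l0; elim: n d v => [|n IH] d v dn.
  by rewrite big_ord0 /= mulr0 mul0r subr0 mulr1 subrr normr0.
rewrite big_ord_recl.
have dn' : forall i, (i < n)%N -> 2 * lam <= `|d i.+1| by move=> i ?; exact: dn.
have := IH (fun i => d i.+1) (fun i => v i.+1) dn'.
have r1 := cfrac_le1 l0 dn.
have := cfrac_denom l0 (dn 0%N isT) (cfrac_le1 l0 dn').
move: r1 (dn 0%N isT) => /=.
set r := cfrac _ _ n; set p := cfprod _ _ n.
set S := \sum_(i < n) _.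
set D := d 0%N + lam * r => r1 d0 [D1 _] H.
have D0 : D != 0 by rewrite -normr_gt0; lra.
set g := lam * (v 0%N + v 2%N) + d 0%N * v 1%N.
set e := lam * v 2%N - lam * r * v 1%N - lam * p * v n.+2 in H.
have -> : lam * v 1%N - lam * (- lam / D) * v 0%N - lam * (- lam / D * p) * v n.+2
   = (- lam / D) * (e - g).
  by rewrite /e /g; apply: (mulIf D0); rewrite /D; field; rewrite -/D.
rewrite normrM; apply: le_trans (_ : 1 * `|e - g| <= _).
  by apply: ler_wpM2r.
by rewrite mul1r; apply: le_trans (ler_normB _ _) _; rewrite addrC lerD2l.
Qed.

(** One level of the fraction divides by a product of two denominators, each at
    least [eta / 2], and the inner fraction contributes at most as much as its own
    head because [8 lam <= eta^2]. *)
Lemma cfrac_lip (R : realFieldType) (lam eta eps : R) (n : nat)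
    (d d' : nat -> R) :
  0 < lam <= 1 -> 0 < eta -> 2 * lam <= eta -> 8 * lam <= eta ^+ 2 ->
  0 <= eps ->
  (forall i, (i < n)%N -> eta <= `|d i|) ->
  (forall i, (i < n)%N -> eta <= `|d' i|) ->
  (forall i, (i < n)%N -> `|d i - d' i| <= eps) ->
  `|cfrac lam d n - cfrac lam d' n| <= 8 * lam / eta ^+ 2 * eps.
Proof.
move=> /andP[l0 l1] eta0 le2 le8 eps0.
have k0 : 0 <= 8 * lam / eta ^+ 2.
  by rewrite divr_ge0 ?exprn_ge0// ltW// mulr_gt0.
elim: n d d' => [|n IH] d d' dn dn' dd /=.
  by rewrite subrr normr0 mulr_ge0.
have r1 : `|cfrac lam (fun i => d i.+1) n| <= 1.
  by apply: cfrac_le1 => // i ?; apply: le_trans le2 _; exact: dn.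
have r1' : `|cfrac lam (fun i => d' i.+1) n| <= 1.
  by apply: cfrac_le1 => // i ?; apply: le_trans le2 _; exact: dn'.
have {}IH := IH (fun i => d i.+1) (fun i => d' i.+1) (fun i => dn i.+1)
  (fun i => dn' i.+1) (fun i => dd i.+1).
have [D1 _] := cfrac_denom l0 (le_trans le2 (dn 0%N isT)) r1.
have [D1' _] := cfrac_denom l0 (le_trans le2 (dn' 0%N isT)) r1'.
move: IH D1 D1' (dn 0%N isT) (dn' 0%N isT) (dd 0%N isT).
set r := cfrac _ _ n; set r' := cfrac _ _ n.
set D := d 0%N + lam * r; set D' := d' 0%N + lam * r' => IH D1 D1' e1 e1' de.
have D0 : D != 0 by rewrite -normr_gt0; lra.
have D0' : D' != 0 by rewrite -normr_gt0; lra.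
have -> : - lam / D - - lam / D' = lam * (D - D') / (D * D').
  by field; rewrite D0 D0'.
rewrite normrM normrM normfV normrM (gtr0_norm l0).
have DD : eta ^+ 2 / 4 <= `|D| * `|D'|.
  have -> : eta ^+ 2 / 4 = (eta / 2) * (eta / 2) by field.
  by apply: ler_pM; lra.
have e20 : 0 < eta ^+ 2 by rewrite exprn_gt0.
rewrite ler_pdivrMr; last by apply: lt_le_trans DD; rewrite divr_gt0.
have H : `|D - D'| <= 2 * eps.
  have -> : D - D' = (d 0%N - d' 0%N) + lam * (r - r') by rewrite /D /D'; ring.
  apply: le_trans (ler_normD _ _) _; rewrite normrM (gtr0_norm l0).
  have : lam * `|r - r'| <= eps.
    apply: le_trans (_ : 1 * (1 * eps) <= _); last by rewrite !mul1r.
    apply: ler_pM => //; first by apply: ltW.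
    apply: le_trans IH _; apply: ler_wpM2r => //.
    by rewrite ler_pdivrMr// mul1r.
  by lra.
apply: le_trans (_ : lam * (2 * eps) <= _).
  by apply: ler_wpM2l => //; exact: ltW.
apply: le_trans (_ : 8 * lam / eta ^+ 2 * eps * (eta ^+ 2 / 4) <= _); last first.
  by apply: ler_wpM2l => //; rewrite mulr_ge0.
by rewrite le_eqVlt; apply/orP; left; apply/eqP; field; rewrite gt_eqF.
Qed.

Lemma cfprod_ub (R : realFieldType) (lam : R) (n : nat) (d e : nat -> R) :
  0 < lam -> (forall i, (i < n)%N -> 2 * lam <= `|d i|) ->
  (forall i, (i < n)%N -> 0 < e i <= `|d i| - lam) ->
  `|cfprod lam d n| <= \prod_(i < n) (lam / e i).
Proof.
move=> l0; elim: n d e => [|n IH] d e dn de; first by rewrite big_ord0 normr1.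
rewrite big_ord_recl /= normrM.
have r1 : `|cfrac lam (fun i => d i.+1) n| <= 1.
  by apply: cfrac_le1 => // i ?; exact: dn.
have [_ H] := cfrac_denom l0 (dn 0%N isT) r1.
have /andP[e0 e1] := de 0%N isT.
apply: ler_pM => //; last by apply: (IH _ (fun i => e i.+1)) => i ?; [exact: dn|exact: de].
rewrite normrM normrN normfV (gtr0_norm l0); apply: ler_wpM2l; first exact: ltW.
by rewrite lef_pV2 ?posrE; lra.
Qed.

Lemma cfprod_lb (R : realFieldType) (lam : R) (n : nat) (d e : nat -> R) :
  0 < lam -> (forall i, (i < n)%N -> 2 * lam <= d i) ->
  (forall i, (i < n)%N -> d i + lam <= e i) ->
  \prod_(i < n) (lam / e i) <= (-1) ^+ n * cfprod lam d n.
Proof.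
move=> l0; elim: n d e => [|n IH] d e dn de.
  by rewrite big_ord0 expr0 mulr1.
rewrite big_ord_recl /= exprS.
have r1 : `|cfrac lam (fun i => d i.+1) n| <= 1.
  by apply: cfrac_le1 => // i ?; apply: le_trans (ler_norm _); exact: dn.
have := dn 0%N isT; have := de 0%N isT.
set r := cfrac _ _ n in r1 *; set D := d 0%N + lam * r => h1 h2.
have : `|lam * r| <= lam by rewrite normrM gtr0_norm// ler_piMr// ltW.
rewrite ler_norml => /andP[h3 h4].
have -> : -1 * (-1) ^+ n * (- lam / D * cfprod lam (fun i => d i.+1) n)
  = lam / D * ((-1) ^+ n * cfprod lam (fun i => d i.+1) n) by ring.
apply: ler_pM => //.
- by rewrite divr_ge0; lra.
- apply: prodr_ge0 => i _; rewrite divr_ge0//; first exact: ltW.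
  by have := dn (lift ord0 i) (ltn_ord _); have := de (lift ord0 i) (ltn_ord _); lra.
- by apply: ler_wpM2l; [exact: ltW|]; rewrite lef_pV2 ?posrE /D; lra.
- by apply: (IH _ (fun i => e i.+1)) => i ?; [exact: dn|exact: de].
Qed.

(** * Sines, cosines and exponentials *)

Lemma pi_le4 (R : realType) : (pi : R) <= 4.
Proof. by have := @pihalf_lt2 R; lra. Qed.

Lemma sin_MVT (R : realType) (a b : R) : a <= b ->
  exists2 c, a <= c <= b & sin b - sin a = cos c * (b - a).
Proof.
move=> ab; have [c cab ->] := @MVT_segment R sin cos a b ab (fun x _ => is_derive_sin x)
  (continuous_subspaceT (@continuous_sin R)).
by exists c => //; move: cab; rewrite in_itv.
Qed.

Lemma sin_lip (R : realType) (x y : R) : `|sin x - sin y| <= `|x - y|.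
Proof.
wlog xy : x y / y <= x.
  move=> H; case: (leP y x) => [/H//|/ltW/H].
  by rewrite distrC [X in _ <= X]distrC.
have [c _ ->] := sin_MVT xy.
by rewrite normrM ler_piMl// cos_max.
Qed.

Lemma cos_lip (R : realType) (x y : R) : `|cos x - cos y| <= `|x - y|.
Proof.
rewrite -!sinDpihalf; apply: le_trans (sin_lip _ _) _.
by rewrite opprD addrACA subrr addr0.
Qed.

Lemma cosBcos (R : realType) (x y : R) :
  cos x - cos y = - 2 * sin ((x + y) / 2) * sin ((x - y) / 2).
Proof.
have -> : cos x = cos ((x + y) / 2 + (x - y) / 2) by congr cos; field.
have -> : cos y = cos ((x + y) / 2 - (x - y) / 2) by congr cos; field.
by rewrite cosB cosD; ring.
Qed.

(** Concavity of the sine on a quarter period, by comparing its slopes on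
    the two sides of the point. *)
Lemma sin_jordan (R : realType) (t : R) : 0 <= t <= 1 / 2 -> 2 * t <= sin (pi * t).
Proof.
move=> /andP[t0 t1].
have p0 := @pi_gt0 R.
have [->|tn0] := eqVneq t 0; first by rewrite !mulr0 sin0.
have [->|tn1] := eqVneq t (1 / 2).
  by rewrite mul1r sin_pihalf; lra.
have {}t0 : 0 < t by rewrite lt_neqAle eq_sym tn0.
have {}t1 : t < 1 / 2 by rewrite lt_neqAle tn1.
have pt0 : 0 < pi * t by rewrite mulr_gt0.
have pt1 : pi * t < pi / 2 by rewrite ltr_pM2l//; lra.
rewrite leNgt; apply/negP => H.
have [c /andP[c0 c1]] := sin_MVT (ltW pt0).
rewrite sin0 !subr0 => e1.
have [d /andP[d0 d1]] := sin_MVT (ltW pt1).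
rewrite sin_pihalf => e2.
have cd : cos d <= cos c.
  by rewrite leNgt ltr_cos ?in_itv/= -?leNgt; lra.
have h1 : cos c * pi < 2.
  by rewrite -(ltr_pM2r t0) -mulrA -e1.
have h2 : 2 < cos d * pi.
  have : 0 < 1 / 2 - t by lra.
  move=> /ltr_pM2r <-; apply: (@lt_le_trans _ _ (1 - sin (pi * t))); first lra.
  by rewrite e2 le_eqVlt; apply/orP; left; apply/eqP; field.
have : cos d * pi <= cos c * pi by rewrite ler_pM2r.
lra.
Qed.

Lemma sin_jordan2 (R : realType) (s t : R) : 0 <= s -> s <= t -> s <= 1 - t ->
  2 * s <= sin (pi * t).
Proof.
move=> s0 st s1; case: (leP t (1 / 2)) => t1.
  by apply: le_trans (_ : 2 * t <= _); [lra|apply: sin_jordan; lra].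
have -> : sin (pi * t) = sin (pi * (1 - t)).
  by rewrite mulrBr mulr1 sinB sinpi cospi; ring.
by apply: le_trans (_ : 2 * (1 - t) <= _); [lra|apply: sin_jordan; lra].
Qed.

Lemma cosDpi2z (R : realType) (x : R) (n : int) : cos (x + pi * (2 * n%:~R)) = cos x.
Proof.
have H (m : nat) u : cos (u + pi * (2 * m%:R)) = cos u :> R.
  have -> : pi * (2 * m%:R) = (pi *+ 2) *+ m :> R by rewrite -mulrnA -[RHS]mulr_natr natrM.
  exact: (periodicn (@cosD2pi R)).
case: n => m; first exact: H.
rewrite NegzE mulrNz -(H m.+1 (x + _)); congr cos.
by rewrite -pmulrn; ring.
Qed.

Lemma expR1_ge2 (R : realType) : 2 <= expR 1 :> R.
Proof. by apply: le_trans (@expR_ge1Dx R 1); lra. Qed.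

Lemma expR_ge_id (R : realType) (x : R) : x <= expR x.
Proof. by apply: le_trans (@expR_ge1Dx R x); lra. Qed.

(** The product [(2h)^n n!] is the reciprocal of a single term of the exponential
    series of [1/(2h)], so it is bounded below uniformly in [n]. *)
Lemma prod_lin_ge (R : realType) (h : R) (n : nat) : 0 < h ->
  expR (- (1 / (2 * h))) <= \prod_(i < n) (2 * h * i.+1%:R).
Proof.
move=> h0; have H0 : 0 <= 1 / (2 * h) by rewrite divr_ge0// mulr_ge0// ltW.
have -> : \prod_(i < n) (2 * h * i.+1%:R) = (2 * h) ^+ n * n`!%:R.
  elim: n => [|n IH]; first by rewrite big_ord0 expr0 fact0 mulr1.
  by rewrite big_ord_recr /= IH exprS factS natrM; ring.
case: n => [|n]; first by rewrite expr0 fact0 mulr1 expR_le1 oppr_le0.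
rewrite expRN -[leRHS]invrK lef_pV2 ?posrE ?invr_gt0 ?expR_gt0//; last first.
  by rewrite mulr_gt0 ?exprn_gt0 ?mulr_gt0// ltr0n fact_gt0.
apply: le_trans (_ : 1 + (1 / (2 * h)) ^+ n.+1 / n.+1`!%:R <= _).
  rewrite invfM div1r exprVn -exprVn; lra.
exact: expR_ge1Dxn.
Qed.

(** * Intermediate values of Lipschitz functions *)

Lemma lip_continuous (R : realType) (f : R -> R) (K : R) : 0 < K ->
  (forall x y, `|f x - f y| <= K * `|x - y|) -> continuous f.
Proof.
move=> K0 Hf x; apply/cvgrPdist_le => e e0.
have eK : 0 < e / K by rewrite divr_gt0.
near=> y; apply: le_trans (Hf _ _) _; rewrite mulrC -ler_pdivlMr//.
Unshelve. all: by end_near. Qed.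

Lemma clamp_lip (R : realType) (a b x y : R) : a <= b ->
  `|Num.max a (Num.min b x) - Num.max a (Num.min b y)| <= `|x - y|.
Proof.
move=> ab; wlog xy : x y / y <= x.
  move=> H; case: (leP y x) => [/H//|/ltW/H].
  by rewrite distrC [X in _ <= X]distrC.
rewrite [X in _ <= X]ger0_norm ?subr_ge0//.
case: (leP b x) => bx; case: (leP b y) => bY; rewrite ?(max_r ab);
  try case: (leP a x) => ax; try case: (leP a y) => ay;
  by rewrite ler_norml; apply/andP; split; lra.
Qed.

Lemma lip_IVT (R : realType) (f : R -> R) (a b K : R) : a <= b -> 0 < K ->
  (forall x y, a <= x <= b -> a <= y <= b -> `|f x - f y| <= K * `|x - y|) ->
  f b <= 0 <= f a -> exists2 c, a <= c <= b & f c = 0.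
Proof.
move=> ab K0 Hf /andP[fb fa].
pose cl x := Num.max a (Num.min b x).
have clab x : a <= cl x <= b.
  rewrite /cl le_max lexx /= ge_max ab /=.
  by case: (leP b x) => // /ltW.
have cla x : a <= x <= b -> cl x = x.
  by move=> /andP[ax xb]; rewrite /cl min_r// max_r.
have gc : continuous (f \o cl).
  apply: (lip_continuous K0) => x y /=; apply: le_trans (Hf _ _ _ _) _ => //.
  by apply: ler_wpM2l; [exact: ltW|exact: clamp_lip].
have [| c] := @IVT R (f \o cl) a b 0 ab (continuous_subspaceT gc).
  rewrite /= !cla ?lexx ?ab//; apply/andP; split.
    by rewrite ge_min fb orbT.
  by rewrite le_max fa.
by rewrite in_itv /= => cab; rewrite cla// => fc; exists c.
Qed.

(** * Two by two systems and phases *)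

(** Multiplying the first equation by [y], the second by [x] and adding leaves
    [T1 y^2 + T2 x^2 + (F1 + F2) x y].  Only the sum of the diagonal entries
    enters; this is what makes the resonant system invertible even where both
    entries vanish, and also where they are large and opposite. *)
Lemma two_by_two_offdiag (R : realFieldType) (t sg F1 F2 T1 T2 x y e : R) :
  0 < t -> `|sg| = 1 -> 3 / 4 * t <= sg * T1 -> 3 / 4 * t <= sg * T2 ->
  `|F1 + F2| <= 5 / 4 * t ->
  `|F1 * x + T1 * y| <= e -> `|F2 * y + T2 * x| <= e -> `|x| <= 16 / t * e.
Proof.
move=> t0 sg1 h1 h2 hF he1 he2.
have e0 : 0 <= e by apply: le_trans he1.
set e1 := F1 * x + T1 * y in he1; set e2 := F2 * y + T2 * x in he2.
have key : t / 8 * (x ^+ 2 + y ^+ 2) <= e * (`|x| + `|y|).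
  have up : sg * (e1 * y + e2 * x) <= e * (`|x| + `|y|).
    apply: le_trans (ler_norm _) _; rewrite normrM sg1 mul1r.
    apply: le_trans (ler_normD _ _) _; rewrite !normrM mulrDr addrC.
    by apply: lerD; apply: ler_wpM2r.
  apply: le_trans up.
  have -> : sg * (e1 * y + e2 * x) =
      (sg * T1) * y ^+ 2 + (sg * T2) * x ^+ 2 + sg * (F1 + F2) * (x * y).
    by rewrite /e1 /e2; ring.
  have a1 : 3 / 4 * t * y ^+ 2 <= (sg * T1) * y ^+ 2 by rewrite ler_wpM2r ?sqr_ge0.
  have a2 : 3 / 4 * t * x ^+ 2 <= (sg * T2) * x ^+ 2 by rewrite ler_wpM2r ?sqr_ge0.
  have a3 : - (5 / 4 * t * `|x * y|) <= sg * (F1 + F2) * (x * y).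
    rewrite lerNl; apply: le_trans (ler_norm _) _.
    by rewrite normrN normrM normrM sg1 mul1r ler_wpM2r.
  have a4 : 2 * `|x * y| <= x ^+ 2 + y ^+ 2.
    rewrite normrM -[x ^+ 2]real_normK ?num_real// -[y ^+ 2]real_normK ?num_real//.
    have : 0 <= (`|x| - `|y|) ^+ 2 by rewrite sqr_ge0.
    by rewrite sqrrB mulr_natl; lra.
  have a5 : t * (2 * `|x * y|) <= t * (x ^+ 2 + y ^+ 2) by rewrite ler_pM2l.
  by lra.
have sq : (`|x| + `|y|) ^+ 2 <= 2 * (x ^+ 2 + y ^+ 2).
  rewrite -[x ^+ 2]real_normK ?num_real// -[y ^+ 2]real_normK ?num_real//.
  have : 0 <= (`|x| - `|y|) ^+ 2 by rewrite sqr_ge0.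
  rewrite sqrrB sqrrD; lra.
have xy : (`|x| + `|y|) * t <= 16 * e.
  case: (ltrP 0 (`|x| + `|y|)) => [xy|xy]; last first.
    by apply: le_trans (_ : 0 <= _); [rewrite mulr_le0_ge0// ltW|rewrite mulr_ge0].
  rewrite -(ler_pM2r xy) mulrAC -expr2.
  have := ler_wpM2r (ltW t0) sq; lra.
rewrite mulrAC ler_pdivlMr//; apply: le_trans xy; rewrite ler_pM2r//.
by rewrite lerDl.
Qed.

Lemma two_by_two_diag (R : realFieldType) (t F1 F2 T1 T2 x y e : R) :
  0 < t -> t <= `|F1| -> t <= `|F2| -> 2 * `|T1| <= `|F1| -> 2 * `|T2| <= `|F2| ->
  `|F1 * x + T1 * y| <= e -> `|F2 * y + T2 * x| <= e -> `|x| <= 16 / t * e.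
Proof.
move=> t0 f1 f2 h1 h2 he1 he2.
have e0 : 0 <= e by apply: le_trans he1.
have H (F T u v : R) : t <= `|F| -> 2 * `|T| <= `|F| -> `|F * u + T * v| <= e ->
    `|u| - `|v| / 2 <= e / t.
  move=> f h hue; case: (ltrP (`|u| - `|v| / 2) 0) => [lt0|ge0].
    by apply: le_trans (ltW lt0) _; rewrite divr_ge0// ltW.
  rewrite ler_pdivlMr//; apply: le_trans hue.
  apply: le_trans (_ : `|F * u| - `|T * v| <= _); last first.
    by have := lerB_normD (F * u) (T * v).
  rewrite !normrM; apply: le_trans (_ : (`|u| - `|v| / 2) * `|F| <= _).
    by apply: ler_wpM2l.
  have := ler_wpM2r (normr_ge0 v) h; lra.
have := H _ _ _ _ f1 h1 he1; have := H _ _ _ _ f2 h2 he2.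
have : 0 <= e / t by rewrite divr_ge0// ltW.
rewrite mulrAC -mulrA; have := normr_ge0 x; have := normr_ge0 y; lra.
Qed.

(** Cosines of [pi t] depend on [t] modulo 2 and up to sign only, so every phase
    has a representative in the unit interval. *)
Lemma angle_reduce (R : realType) (t : R) : exists (n : int) (t' : R),
  0 <= t' <= 1 /\ (t = 2 * n%:~R + t' \/ t = 2 * n%:~R - t').
Proof.
pose n := Num.floor ((t + 1) / 2); have := floor_itv ((t + 1) / 2).
rewrite -/n intrD => /andP[n1 n2].
have m1 : 2 * n%:~R <= t + 1 by move: n1; rewrite ler_pdivlMr// mulrC.
have m2 : t + 1 < 2 * n%:~R + 2 by move: n2; rewrite ltr_pdivrMr//; lra.
exists n; case: (leP (2 * n%:~R) t) => H.
  by exists (t - 2 * n%:~R); split; [lra|left; ring].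
by exists (2 * n%:~R - t); split; [lra|right; ring].
Qed.

(** * Resonant pairs of the dual operator *)

(** The parameter [z] bounds from below every quantity that may appear in a
    denominator: [h], the inverse of [k], the products of sines, and [1 - 2 h k],
    which vanishes when the last site of the right chain is resonant too.  The exponent 20
    leaves room for all powers of [z] lost on the way. *)
Record small_coupling (R : realType) (h lam z : R) (k : nat) : Prop := SmallCoupling {
  sc_k : (0 < k)%N;
  sc_z0 : 0 < z;
  sc_z4 : z <= 1 / 4;
  sc_zh : z <= h;
  sc_zy : z <= 1 - 2 * h * k%:R;
  sc_z4k : z * 4 ^+ k <= 1;
  sc_zk : z * k%:R <= 1 / 4;
  sc_zP : forall n, z <= (\prod_(i < n) (2 * h * i.+1%:R)) ^+ 2;
  sc_l0 : 0 < lam;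
  sc_lz : lam <= z ^+ 20 }.

Lemma sin2_prodE (R : realType) (h : R) (k : nat) :
  sin2_prod h k = \prod_(i < k.-1) sin (pi * (h * i.+1%:R)) ^+ 2.
Proof.
rewrite /sin2_prod; case: k => [|k]; first by rewrite big_geq// big_ord0.
by rewrite big_add1 big_mkord; apply: eq_bigr => i _; rewrite mulrA.
Qed.

Section Resonance.
Context (R : realType) (h lam z : R) (k : nat) (Sc : small_coupling h lam z k).

(** The diagonal of the dual operator at the site of phase [t]. *)
Definition dual_pot (E t : R) : R := 2 * cos (pi * t) - E.

(** The energy at which the phases [h k] and [- h k] are both resonant. *)
Definition res_energy : R := 2 * cos (pi * (h * k%:R)).

(** The diagonal along the [k] sites to the right of the resonant site of phase
    [h k + s], going away from its partner; [left_pot] goes towards the partner,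
    of phase [- h k + s], which is met after [k] steps. *)
Definition right_pot (E s : R) (i : nat) : R :=
  dual_pot E (h * k%:R + 2 * h * i.+1%:R + s).

Definition left_pot (E s : R) (i : nat) : R :=
  dual_pot E (h * k%:R - 2 * h * i.+1%:R + s).

(** The values of [- right_pot] and [left_pot] at exact resonance, by the
    product formula for a difference of cosines. *)
Definition right_det (i : nat) : R :=
  4 * sin (pi * (h * i.+1%:R)) * sin (pi * (h * (k + i.+1)%:R)).

Definition left_det (i : nat) : R :=
  4 * sin (pi * (h * i.+1%:R)) * sin (pi * (h * (k - i.+1)%:R)).

(** The diagonal at the resonant site, corrected by the self-energies of the two
    chains that have been eliminated. *)
Definition eff_diag (E s : R) : R :=
  dual_pot E (h * k%:R + s) + lam * cfrac lam (right_pot E s) k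
  + lam * cfrac lam (left_pot E s) k.-1.

(** The coupling of the resonant site to its partner, at distance [k] on the
    left. *)
Definition tunnel (E s : R) : R := lam * cfprod lam (left_pot E s) k.-1.

(** The coupling of the resonant site to the first site beyond the right chain.
    That chain is one site longer than the left one, so [leak] carries one more
    factor [lam] than [tunnel]. *)
Definition leak (E s : R) : R := lam * cfprod lam (right_pot E s) k.

(** The size of the tunnelling term, which is half the length of the gap in the
    leading order. *)
Definition half_gap : R := 4 * (lam / 4) ^+ k / sin2_prod h k.

Local Lemma h_gt0 : 0 < h. Proof. by case: Sc => *; lra. Qed.

Local Lemma zX_gt0 n : 0 < z ^+ n. Proof. by rewrite exprn_gt0//; case: Sc. Qed.

Local Lemma zXS_le n : z ^+ n.+1 <= z ^+ n / 4.
Proof.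
rewrite exprSr; apply: ler_wpM2l; first exact/ltW/zX_gt0.
by have := sc_z4 Sc; lra.
Qed.

Local Lemma zXD_le m n : z ^+ (m + n) <= z ^+ m / 4 ^+ n.
Proof.
elim: n => [|n IH]; first by rewrite addn0 expr0 divr1.
rewrite addnS; apply: le_trans (zXS_le _) _; rewrite exprS invfM mulrCA.
rewrite [X in X <= _]mulrC; apply: ler_wpM2l => //; lra.
Qed.

Local Lemma lam_le_zX n m : (n + m <= 20)%N -> lam <= z ^+ n / 4 ^+ m.
Proof.
move=> nm; apply: le_trans (sc_lz Sc) _.
apply: le_trans (zXD_le _ _).
have -> : (20 = n + m + (20 - (n + m)))%N by rewrite subnKC.
apply: le_trans (zXD_le _ _) _.
rewrite ler_pdivrMr ?exprn_gt0//.
by rewrite ler_peMr ?exprn_ege1 ?ler1n// ltW ?zX_gt0.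
Qed.

Local Lemma sin_site (j : nat) : (0 < j)%N -> (j <= 2 * k)%N ->
  2 * z <= sin (pi * (h * j%:R)).
Proof.
move=> j0 jk; have hp := h_gt0; case: Sc => _ z0 _ zh zy _ _ _ _ _.
have j1 : 1 <= j%:R :> R by rewrite ler1n.
have j2 : j%:R <= 2 * k%:R :> R by rewrite -natrM ler_nat.
apply: sin_jordan2; [exact: ltW| |].
  by apply: le_trans zh _; rewrite ler_peMr// ltW.
apply: le_trans zy _; rewrite lerD2l lerN2 -mulrA mulrCA.
by apply: ler_wpM2l => //; exact: ltW.
Qed.

Local Lemma dual_potE E t t' : dual_pot E t - (2 * cos (pi * t') - res_energy) =
  2 * (cos (pi * t) - cos (pi * t')) - (E - res_energy).
Proof. by rewrite /dual_pot; ring. Qed.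

Local Lemma cospi_lip (t t' : R) : `|cos (pi * t) - cos (pi * t')| <= 4 * `|t - t'|.
Proof.
apply: le_trans (cos_lip _ _) _; rewrite -mulrBr normrM.
by apply: ler_wpM2r => //; rewrite ger0_norm ?pi_ge0// pi_le4.
Qed.

Local Lemma dual_pot_near E t t' :
  `|dual_pot E t - (2 * cos (pi * t') - res_energy)| <= 8 * `|t - t'| + `|E - res_energy|.
Proof.
rewrite dual_potE; apply: le_trans (ler_normB _ _) _; rewrite lerD2r normrM.
rewrite ger0_norm//; have := cospi_lip t t'; lra.
Qed.

Local Lemma right_pot_near E s i : `|right_pot E s i + right_det i| <= 8 * `|s| + `|E - res_energy|.
Proof.
have := dual_pot_near E (h * k%:R + 2 * h * i.+1%:R + s) (h * k%:R + 2 * h * i.+1%:R).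
rewrite [X in 8 * `|X|](_ : _ = s); last by ring.
congr (`|_| <= _); rewrite /right_pot; congr (_ + _).
rewrite /res_energy -mulrBr cosBcos /right_det.
have -> : (pi * (h * k%:R + 2 * h * i.+1%:R) + pi * (h * k%:R)) / 2 =
  pi * (h * (k + i.+1)%:R) by rewrite natrD; field.
have -> : (pi * (h * k%:R + 2 * h * i.+1%:R) - pi * (h * k%:R)) / 2 =
  pi * (h * i.+1%:R) by field.
by ring.
Qed.

Local Lemma left_pot_near E s i : (i < k)%N ->
  `|left_pot E s i - left_det i| <= 8 * `|s| + `|E - res_energy|.
Proof.
move=> ik.
have := dual_pot_near E (h * k%:R - 2 * h * i.+1%:R + s) (h * k%:R - 2 * h * i.+1%:R).
rewrite [X in 8 * `|X|](_ : _ = s); last by ring.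
congr (`|_| <= _); rewrite /right_pot; congr (_ + _).
rewrite /res_energy -mulrBr cosBcos /left_det.
have -> : (pi * (h * k%:R - 2 * h * i.+1%:R) + pi * (h * k%:R)) / 2 =
  pi * (h * (k - i.+1)%:R) by rewrite natrB//; field.
have -> : (pi * (h * k%:R - 2 * h * i.+1%:R) - pi * (h * k%:R)) / 2 =
  - (pi * (h * i.+1%:R)) by field.
by rewrite sinN; ring.
Qed.

Local Lemma prod_sites_ge (i j : nat) : (0 < i <= 2 * k)%N -> (0 < j <= 2 * k)%N ->
  z ^+ 3 <= 4 * sin (pi * (h * i%:R)) * sin (pi * (h * j%:R)).
Proof.
move=> /andP[i0 i1] /andP[j0 j1]; have z0 := sc_z0 Sc; have z4 := sc_z4 Sc.
have := sin_site i0 i1; have := sin_site j0 j1 => hi hj.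
rewrite -mulrA; apply: le_trans (_ : 4 * (2 * z * (2 * z)) <= _).
  have := zXS_le 2; have := zX_gt0 2; rewrite expr2; lra.
by apply: ler_wpM2l => //; apply: ler_pM => //; lra.
Qed.

Local Lemma right_det_ge i : (i < k)%N -> z ^+ 3 <= right_det i.
Proof.
move=> ik; apply: prod_sites_ge; rewrite ?addnS /=; last by rewrite mul2n -addnn -addnS leq_add.
by rewrite mul2n -addnn ltn_addl.
Qed.

Local Lemma left_det_ge i : (i < k.-1)%N -> z ^+ 3 <= left_det i.
Proof.
rewrite ltn_predRL => ik; apply: prod_sites_ge; first by rewrite mul2n -addnn ltn_addr// ltnW.
rewrite subn_gt0 ik /=; apply: leq_trans (leq_subr _ _) _.
by rewrite mul2n -addnn leq_addr.
Qed.

(** The scales are chosen so that a resonant phase still moves the diagonal by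
    far less than the detunings [z^3] of the neighbouring sites, whereas a phase
    outside [z^6] leaves a diagonal of size at least [z^12] ([nonres_pot]), much
    larger than [lam]. *)
Definition near_res (E s : R) := `|s| <= z ^+ 6 /\ `|E - res_energy| <= z ^+ 12.

Local Lemma near_resN E s : near_res E s -> near_res E (- s).
Proof. by rewrite /near_res normrN. Qed.

Local Lemma near_res_err E s : near_res E s ->
  8 * `|s| + `|E - res_energy| + lam <= z ^+ 3 / 4.
Proof.
move=> [s1 E1]; have h1 : z ^+ 6 <= z ^+ 3 / 4 ^+ 3 := zXD_le 3 3.
have h2 : z ^+ 12 <= z ^+ 3 / 4 ^+ 9 := zXD_le 3 9.
by have := @lam_le_zX 3 3 isT; have := zX_gt0 3; lra.
Qed.

Local Lemma right_pot_ge E s i : near_res E s -> (i < k)%N ->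
  right_det i / 2 <= `|right_pot E s i| - lam /\ z ^+ 3 / 2 <= `|right_pot E s i|.
Proof.
move=> /near_res_err H ik; have := right_pot_near E s i; have := right_det_ge ik => h1 h2.
have l0 := sc_l0 Sc; have := zX_gt0 3 => h3.
have : `|right_det i| - `|right_pot E s i| <= `|right_pot E s i + right_det i|.
  by rewrite [right_pot E s i + _]addrC; exact: lerB_normD.
have := ler_norm (right_det i); split; lra.
Qed.

Local Lemma left_pot_ge E s i : near_res E s -> (i < k.-1)%N ->
  left_det i / 2 <= left_pot E s i - lam /\ z ^+ 3 / 2 <= left_pot E s i.
Proof.
move=> /near_res_err H ik; have := left_det_ge ik => h1.
have /(left_pot_near E s) : (i < k)%N by apply: leq_trans ik (leq_pred _).
have l0 := sc_l0 Sc; have := zX_gt0 3 => h3.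
rewrite ler_norml => /andP[h4 h5]; split; lra.
Qed.

Local Lemma lam_right_pot E s i : near_res E s -> (i < k)%N -> 2 * lam <= `|right_pot E s i|.
Proof.
move=> n /(right_pot_ge n)[_ H]; have := @lam_le_zX 3 3 isT; have := zX_gt0 3; lra.
Qed.

Local Lemma lam_left_pot E s i : near_res E s -> (i < k.-1)%N -> 2 * lam <= left_pot E s i.
Proof.
move=> n /(left_pot_ge n)[_ H]; have := @lam_le_zX 3 3 isT; have := zX_gt0 3; lra.
Qed.

Definition dual_res (E s : R) (w : int -> R) (j : int) : R :=
  lam * (w (j + 1) + w (j - 1)) + dual_pot E (h * k%:R + 2 * h * j%:~R + s) * w j.

(** The resonant site after the elimination of both of its chains: it sees its
    partner through [tunnel] and the rest of the lattice through [leak] only. *)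
Local Lemma site_elim E s (w : int -> R) (G : R) : near_res E s ->
  (forall j : int, `|j| <= k%:Z -> `|dual_res E s w j| <= G) ->
  `|eff_diag E s * w 0 + tunnel E s * w (- k%:Z) + leak E s * w k.+1%:Z|
    <= (2 * k)%:R * G.
Proof.
move=> nr HG; have l0 := sc_l0 Sc; have k0 := sc_k Sc.
have HR := @chain_elim _ lam k (right_pot E s) (fun i => w i%:Z) l0
  (fun i ik => lam_right_pot nr ik).
have HL := @chain_elim _ lam k.-1 (left_pot E s) (fun i => w (- i%:Z)) l0
  (fun i ik => le_trans (lam_left_pot nr ik) (ler_norm _)).
have SR : \sum_(i < k) `|lam * (w i%:Z + w i.+2%:Z) + right_pot E s i * w i.+1%:Z|
    <= k%:R * G.
  rewrite mulr_natl -[X in _ *+ X]card_ord -sumr_const; apply: ler_sum => i _.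
  have -> : lam * (w i%:Z + w i.+2%:Z) + right_pot E s i * w i.+1%:Z =
     dual_res E s w i.+1%:Z.
    have e1 : i.+1%:Z + 1 = i.+2%:Z by rewrite -PoszD addn1.
    have e2 : i.+1%:Z - 1 = i%:Z by rewrite -addn1 PoszD addrK.
    by rewrite /dual_res e1 e2 [w i%:Z + _]addrC.
  by apply: HG; rewrite ger0_norm// lez_nat.
have SL : \sum_(i < k.-1) `|lam * (w (- i%:Z) + w (- i.+2%:Z))
      + left_pot E s i * w (- i.+1%:Z)| <= k.-1%:R * G.
  rewrite mulr_natl -[X in _ *+ X]card_ord -sumr_const; apply: ler_sum => i _.
  have -> : lam * (w (- i%:Z) + w (- i.+2%:Z)) + left_pot E s i * w (- i.+1%:Z) =
     dual_res E s w (- i.+1%:Z).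
    have e1 : - i.+1%:Z + 1 = - i%:Z by rewrite -addn1 PoszD opprD addrNK.
    have e2 : - i.+1%:Z - 1 = - i.+2%:Z by rewrite -[in RHS]addn1 PoszD opprD.
    by rewrite /dual_res e1 e2 mulrNz mulrN.
  apply: HG; rewrite normrN ger0_norm// lez_nat.
  by apply: ltn_trans (ltn_ord i) _; rewrite prednK.
have G0 := HG 0; rewrite normr0 in G0; have {}G0 := G0 isT.
rewrite prednK// in HL.
set a := _ * w k.+1%:Z in HR *.
set b := _ * w (- k%:Z) in HL *.
have -> : eff_diag E s * w 0 + b + a = dual_res E s w 0
  - (lam * w 1 - lam * cfrac lam (right_pot E s) k * w 0 - a)
  - (lam * w (- 1%:Z) - lam * cfrac lam (left_pot E s) k.-1 * w (- 0%:Z) - b).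
  by rewrite /dual_res /eff_diag mulr0 addr0 add0r sub0r oppr0; ring.
apply: le_trans (ler_normB _ _) _.
apply: le_trans (lerD (ler_normB _ _) (lexx _)) _.
have -> : (2 * k)%:R * G = G + k%:R * G + k.-1%:R * G.
  by rewrite -{2}(prednK k0) -{1}(prednK k0) natrM -natr1; ring.
apply: lerD; [apply: lerD => //|]; [exact: le_trans HR SR|exact: le_trans HL SL].
Qed.

(** The sines are at least [2 h j], which reduces the product to [(2h)^n n!]. *)
Local Lemma sin2_prod_ge : z <= sin2_prod h k <= 1.
Proof.
have hp := h_gt0; apply/andP; split; last first.
  rewrite /sin2_prod; apply: prodr_ile1 => j _.
  by rewrite sqr_ge0 -real_normK ?num_real//= expr_le1 ?sin_max.
apply: le_trans (sc_zP Sc k.-1) _.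
rewrite -prodrXl sin2_prodE.
apply: ler_prod => i _; rewrite sqr_ge0 /=.
have i0 : 0 <= 2 * h * (i.+1)%:R by rewrite mulr_ge0// mulr_ge0// ltW.
apply: ler_pM => //; rewrite -mulrA; apply: sin_jordan; apply/andP; split.
- by rewrite mulr_ge0// ltW.
- have := sc_zy Sc; have := sc_z0 Sc.
  have : i.+1%:R <= k%:R :> R by rewrite ler_nat (leq_trans (ltn_ord i))// leq_pred.
  rewrite -(ler_pM2l hp); lra.
- by rewrite mulr_ge0// ltW.
- have := sc_zy Sc; have := sc_z0 Sc.
  have : i.+1%:R <= k%:R :> R by rewrite ler_nat (leq_trans (ltn_ord i))// leq_pred.
  rewrite -(ler_pM2l hp); lra.
Qed.

Local Lemma sin2_prod_gt0 : 0 < sin2_prod h k.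
Proof. by have := sin2_prod_ge; have := sc_z0 Sc; lra. Qed.

Local Lemma half_gap_ge : 4 * (lam / 4) ^+ k <= half_gap.
Proof.
have := sin2_prod_ge; have p0 := sin2_prod_gt0 => /andP[_ p1].
rewrite /half_gap ler_pdivlMr// ler_piMr// mulr_ge0// exprn_ge0// divr_ge0//.
exact/ltW/(sc_l0 Sc).
Qed.

Lemma half_gap_gt0 : 0 < half_gap.
Proof.
apply: lt_le_trans half_gap_ge; rewrite mulr_gt0// exprn_gt0// divr_gt0//.
exact: (sc_l0 Sc).
Qed.

Local Lemma half_gap_le : half_gap * z <= lam.
Proof.
have /andP[p1 _] := sin2_prod_ge; have l0 := sc_l0 Sc.
rewrite /half_gap mulrAC ler_pdivrMr ?sin2_prod_gt0//.
apply: ler_pM => //; [|exact/ltW/(sc_z0 Sc)|].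
  by rewrite mulr_ge0// exprn_ge0// divr_ge0// ltW.
have -> : (lam / 4) ^+ k = lam / 4 * (lam / 4) ^+ k.-1.
  by rewrite -exprS prednK ?(sc_k Sc).
have : (lam / 4) ^+ k.-1 <= 1.
  by apply: exprn_ile1; [lra|]; have := @lam_le_zX 0 1 isT; rewrite expr0; lra.
move=> H; apply: le_trans (_ : 4 * (lam / 4 * 1) <= _); last by lra.
by apply: ler_wpM2l => //; apply: ler_wpM2l => //; lra.
Qed.

Local Lemma half_gap_z n m : (n + m < 20)%N -> half_gap <= z ^+ n / 4 ^+ m.
Proof.
move=> nm; have z0 := sc_z0 Sc; rewrite -(ler_pM2r z0); apply: le_trans half_gap_le _.
by rewrite mulrAC -exprSr; apply: lam_le_zX.
Qed.

Local Lemma prod_left_det : \prod_(i < k.-1) left_det i = 4 ^+ k.-1 * sin2_prod h k.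
Proof.
have S1 : \prod_(i < k.-1) sin (pi * (h * (k - i.+1)%:R)) =
   \prod_(i < k.-1) sin (pi * (h * i.+1%:R)) :> R.
  rewrite (reindex_inj rev_ord_inj) /=; apply: eq_bigr => i _.
  congr (sin (pi * (h * _%:R))); have := ltn_ord i; have := sc_k Sc.
  by move: (nat_of_ord i) => j; case: k => // k' _ /=; lia.
rewrite /left_det !big_split /= S1 prodr_const card_ord -mulrA; congr (_ * _).
rewrite sin2_prodE -big_split /=.
by apply: eq_bigr => i _; rewrite expr2.
Qed.

(** The product of the detunings between the partners, at distances [j] and
    [k - j] from them, contains every sine twice. *)
Local Lemma half_gapE : lam * \prod_(i < k.-1) (lam / left_det i) = half_gap.
Proof.
rewrite big_split /= prodr_const card_ord prodfV prod_left_det.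
rewrite /half_gap; have -> : (lam / 4) ^+ k = lam * lam ^+ k.-1 / (4 * 4 ^+ k.-1).
  by rewrite expr_div_n -!exprS prednK ?(sc_k Sc).
field.
by rewrite gt_eqF ?sin2_prod_gt0// expf_neq0.
Qed.

Local Lemma bernoulli_ge (n : nat) (a : R) : 0 <= a <= 1 ->
  1 - n%:R * a <= (1 - a) ^+ n.
Proof.
move=> /andP[a0 a1]; elim: n => [|n IH]; first by rewrite mul0r subr0 expr0.
rewrite exprS; apply: le_trans (_ : (1 - a) * (1 - n%:R * a) <= _).
  by rewrite -natr1; have : 0 <= n%:R * a * a by [rewrite !mulr_ge0]; lra.
by apply: ler_wpM2l => //; lra.
Qed.

Local Lemma tunnel_ub E s : near_res E s -> `|tunnel E s| <= 2 ^+ k.-1 * half_gap.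
Proof.
move=> nr; have l0 := sc_l0 Sc; rewrite /tunnel normrM (gtr0_norm l0) -half_gapE mulrCA.
apply: ler_wpM2l; first exact: ltW.
rewrite -[X in 2 ^+ X]card_ord -prodr_const -big_split /=.
apply: le_trans (cfprod_ub (e := fun i => left_det i / 2) l0 _ _) _ => [i ik|i ik|].
- exact: le_trans (lam_left_pot nr ik) (ler_norm _).
- have [h1 h2] := left_pot_ge nr ik; have h3 := left_det_ge ik; have h4 := zX_gt0 3.
  have := ler_norm (left_pot E s i); lra.
apply: ler_prod => i _; have h3 := left_det_ge (ltn_ord i); have h4 := zX_gt0 3.
apply/andP; split; first by apply: divr_ge0; lra.
by rewrite invf_div mulrCA.
Qed.

(** All the denominators on the way to the partner are positive, so the
    transmission coefficient has a definite sign; its [k-1] factors lose at most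
    a fraction [z / 2] each, hence less than a quarter altogether. *)
Local Lemma tunnel_lb E s : near_res E s ->
  8 * `|s| + `|E - res_energy| + lam <= z ^+ 3 * (z / 2) ->
  3 / 4 * half_gap <= (-1) ^+ k.-1 * tunnel E s.
Proof.
move=> nr small; have l0 := sc_l0 Sc; have z0 := sc_z0 Sc; have z4 := sc_z4 Sc.
rewrite /tunnel -half_gapE mulrCA [leRHS]mulrCA; apply: ler_wpM2l; first exact: ltW.
pose a : R := z / 2.
have dle i : (i < k.-1)%N -> left_pot E s i + lam <= left_det i / (1 - a).
  move=> ik; have h1 := left_det_ge ik; have z3 := zX_gt0 3.
  have /(left_pot_near E s) : (i < k)%N by apply: leq_trans ik (leq_pred _).
  move=> /(le_trans (ler_norm _)) h2.
  have h3 : z ^+ 3 * (z / 2) <= left_det i * a by apply: ler_wpM2r; rewrite /a; lra.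
  rewrite ler_pdivlMr; last by rewrite /a; lra.
  apply: le_trans (_ : (left_det i + left_det i * a) * (1 - a) <= _).
    by apply: ler_wpM2r; [rewrite /a|]; lra.
  have -> : (left_det i + left_det i * a) * (1 - a) = left_det i - left_det i * a ^+ 2 by ring.
  by rewrite gerBl mulr_ge0 ?sqr_ge0//; lra.
apply: le_trans (cfprod_lb l0 (fun i ik => lam_left_pot nr ik) dle).
have -> : \prod_(i < k.-1) (lam / (left_det i / (1 - a))) =
    \prod_(i < k.-1) (lam / left_det i) * (1 - a) ^+ k.-1.
  rewrite -[X in _ ^+ X]card_ord -prodr_const -big_split /=.
  by apply: eq_bigr => i _; rewrite invf_div mulrA mulrAC.
rewrite mulrC; apply: ler_wpM2l.
  apply: prodr_ge0 => i _; apply: divr_ge0; first exact: ltW.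
  by have := left_det_ge (ltn_ord i); have := zX_gt0 3; lra.
apply: le_trans (@bernoulli_ge k.-1 a _); last by rewrite /a; lra.
have := sc_zk Sc.
have : z * k.-1%:R <= z * k%:R.
  by apply: ler_wpM2l; [lra|rewrite ler_nat leq_pred].
rewrite /a mulrA [X in 1 - X / 2]mulrC; lra.
Qed.

(** The sine of [pi h (k + i)] is at least [2 h (k - i)], because
    [1 - h (k + i) >= h (k - i)]; this is empty for [i = k], where [2 h k] may be
    close to [1] and only the bound [2 z] is left. *)
Local Lemma prod_right_det : 4 ^+ k * (2 * z ^+ 3) <= \prod_(i < k) right_det i.
Proof.
have hp := h_gt0; have z0 := sc_z0 Sc; have z1 := sc_z4 Sc.
pose q n : R := \prod_(i < n) (2 * h * i.+1%:R).
have q0 n : 0 <= q n.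
  by apply: prodr_ge0 => i _; rewrite mulr_ge0// mulr_ge0// ltW.
have qz n : z <= q n.
  rewrite leNgt; apply/negP => H.
  have := sc_zP Sc n; rewrite leNgt => /negP; apply.
  apply: le_lt_trans (_ : z ^+ 2 < z); last first.
    by have : z ^+ 2 <= z ^+ 1 / 4 := zXS_le 1; rewrite expr1; lra.
  by apply: lerXn2r; rewrite ?nnegrE ?q0 ?ltW.
have yk := sc_zy Sc.
have j1 (i : 'I_k) : 2 * (h * i.+1%:R) <= sin (pi * (h * i.+1%:R)).
  apply: sin_jordan; rewrite mulr_ge0 ?(ltW hp)//=.
  have : i.+1%:R <= k%:R :> R by rewrite ler_nat.
  by rewrite -(ler_pM2l hp); lra.
have j2 (i : 'I_k.-1) : 2 * (h * (k - i.+1)%:R) <= sin (pi * (h * (k + i.+1)%:R)).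
  have ik : (i.+1 <= k)%N by have := ltn_ord i; lia.
  have i0 : i.+1%:R <= k%:R :> R by rewrite ler_nat.
  have i1 : 0 <= h * i.+1%:R by rewrite mulr_ge0// ltW.
  rewrite natrB// natrD; move: i0; rewrite -(ler_pM2l hp) => i0.
  by apply: sin_jordan2; rewrite mulrBr ?mulrDr; lra.
have j3 : 2 * z <= sin (pi * (h * (k + k)%:R)).
  by apply: sin_site; rewrite ?mul2n -?addnn ?addn_gt0 ?(sc_k Sc).
rewrite /right_det !big_split /= prodr_const card_ord -mulrA; apply: ler_wpM2l.
  by rewrite exprn_ge0.
have -> : 2 * z ^+ 3 = z * (z * (2 * z)) by ring.
apply: ler_pM; [exact: ltW|by rewrite mulr_ge0//; lra| |].
  apply: le_trans (qz k) _; apply: ler_prod => i _.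
  by rewrite -mulrA mulr_ge0 ?j1// mulr_ge0// ltW.
have [m km] : exists m, k = m.+1 by exists k.-1; rewrite prednK// (sc_k Sc).
have -> : \prod_(i < k) sin (pi * (h * (k + i.+1)%:R)) =
  \prod_(i < k.-1) sin (pi * (h * (k + i.+1)%:R)) * sin (pi * (h * (k + k)%:R)).
  by move: (k) km => k' ->; rewrite big_ord_recr.
apply: ler_pM; [exact: ltW|lra| |exact: j3].
apply: le_trans (qz k.-1) _; rewrite /q (reindex_inj rev_ord_inj) /=.
apply: ler_prod => i _; apply/andP; split.
  by rewrite mulr_ge0// mulr_ge0// ltW.
apply: le_trans (j2 i); rewrite -mulrA ler_pM2l// ler_pM2l// ler_nat.
have := ltn_ord i; lia.
Qed.

Local Lemma leak_ub E s : near_res E s -> `|leak E s| <= z ^+ 12 * half_gap.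
Proof.
move=> nr; have l0 := sc_l0 Sc; have z0 := sc_z0 Sc.
have H : `|cfprod lam (right_pot E s) k| <= (2 * lam) ^+ k / \prod_(i < k) right_det i.
  apply: le_trans (cfprod_ub (e := fun i => right_det i / 2) l0 _ _) _ => [i ik|i ik|].
  - exact: lam_right_pot nr ik.
  - by have [h1 h2] := right_pot_ge nr ik; have h3 := right_det_ge ik; have h4 := zX_gt0 3; lra.
  rewrite -prodfV -[X in _ ^+ X]card_ord -prodr_const -big_split /= le_eqVlt.
  apply/orP; left; apply/eqP; apply: eq_bigr => i _.
  by rewrite invf_div mulrA [lam * 2]mulrC.
have P0 : 0 < 4 ^+ k * (2 * z ^+ 3) :> R by rewrite !mulr_gt0 ?exprn_gt0.
rewrite /leak normrM (gtr0_norm l0).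
apply: le_trans (_ : z ^+ 12 * (4 * (lam / 4) ^+ k) <= _); last first.
  by apply: ler_wpM2l; [exact/ltW/zX_gt0|exact: half_gap_ge].
apply: le_trans (_ : lam * ((2 * lam) ^+ k / (4 ^+ k * (2 * z ^+ 3))) <= _).
  apply: ler_wpM2l; first exact: ltW.
  apply: le_trans H _; apply: ler_wpM2l; first by rewrite exprn_ge0// mulr_ge0// ltW.
  by rewrite lef_pV2 ?posrE//; [exact: prod_right_det|exact: lt_le_trans P0 prod_right_det].
have -> : lam * ((2 * lam) ^+ k / (4 ^+ k * (2 * z ^+ 3))) =
  (lam / (2 * z ^+ 3) * 2 ^+ k) * (lam / 4) ^+ k.
  rewrite exprMn expr_div_n; field.
  by rewrite !expf_neq0 ?gt_eqF.
rewrite [X in _ <= X]mulrA; apply: ler_wpM2r.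
  by rewrite exprn_ge0// divr_ge0// ltW.
rewrite mulrAC ler_pdivrMr ?mulr_gt0 ?zX_gt0//.
have z2 : 2 ^+ k * z <= 1.
  apply: le_trans (sc_z4k Sc); rewrite mulrC; apply: ler_wpM2l; first exact: ltW.
  by apply: lerXn2r; rewrite ?nnegrE; lra.
rewrite -(ler_pM2r z0) -mulrA.
apply: le_trans (_ : lam * 1 <= _); first by apply: ler_wpM2l => //; exact: ltW.
rewrite mulr1; apply: le_trans (@lam_le_zX 16 0 isT) _.
have -> : z ^+ 12 * 4 * (2 * z ^+ 3) * z = 8 * z ^+ 16 by ring.
by rewrite expr0; have := zX_gt0 16; lra.
Qed.

Local Lemma cfrac_err (E s E' s' : R) (n : nat) (d d' : nat -> R) :
  (forall i, (i < n)%N -> z ^+ 3 / 2 <= `|d i|) ->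
  (forall i, (i < n)%N -> z ^+ 3 / 2 <= `|d' i|) ->
  (forall i, (i < n)%N -> `|d i - d' i| <= 8 * `|s - s'| + `|E - E'|) ->
  `|lam * cfrac lam d n - lam * cfrac lam d' n|
    <= z ^+ 8 / 2 * (8 * `|s - s'| + `|E - E'|).
Proof.
move=> h1 h2 h3; have l0 := sc_l0 Sc; have z3 := zX_gt0 3; have z6 := zX_gt0 6.
set eps := 8 * _ + _ in h3 *.
have e0 : 0 <= eps by rewrite addr_ge0// mulr_ge0.
rewrite -mulrBr normrM (gtr0_norm l0).
have l1 := @lam_le_zX 0 1 isT; rewrite expr0 in l1.
have l3 := @lam_le_zX 3 3 isT; have l6 := @lam_le_zX 6 3 isT.
have e2 : (z ^+ 3 / 2) ^+ 2 = z ^+ 6 / 4 by field.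
apply: le_trans (_ : lam * (8 * lam / (z ^+ 6 / 4) * eps) <= _).
  apply: ler_wpM2l; first exact: ltW.
  by rewrite -e2; apply: cfrac_lip => //; rewrite ?e2; lra.
rewrite mulrA; apply: ler_wpM2r => //.
have -> : lam * (8 * lam / (z ^+ 6 / 4)) = 32 * lam ^+ 2 / z ^+ 6.
  by field; rewrite gt_eqF ?(sc_z0 Sc).
rewrite ler_pdivrMr//.
have -> : z ^+ 8 / 2 * z ^+ 6 = (z ^+ 14 / 4 ^+ 3) * 32 by field.
rewrite mulrC ler_pM2r// expr2 -[leRHS]mulr1; apply: ler_pM.
- exact: ltW.
- exact: ltW.
- exact: (@lam_le_zX 14 3 isT).
- lra.
Qed.

(** The potential dominates: the self-energies of the two chains vary at a rate
    that is small with [lam]. *)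
Local Lemma eff_diag_lip E s E' s' : near_res E s -> near_res E' s' ->
  `|eff_diag E s - eff_diag E' s' - (dual_pot E (h * k%:R + s) - dual_pot E' (h * k%:R + s'))|
    <= z ^+ 8 * (8 * `|s - s'| + `|E - E'|).
Proof.
move=> nr nr'.
have pl t t' : t - t' = s - s' ->
    `|dual_pot E t - dual_pot E' t'| <= 8 * `|s - s'| + `|E - E'|.
  move=> tt; have -> : dual_pot E t - dual_pot E' t' =
    2 * (cos (pi * t) - cos (pi * t')) - (E - E') by rewrite /dual_pot; ring.
  apply: le_trans (ler_normB _ _) _; rewrite lerD2r normrM ger0_norm//.
  by have := cospi_lip t t'; rewrite tt; lra.
have pR i : `|right_pot E s i - right_pot E' s' i| <= 8 * `|s - s'| + `|E - E'|.
  by apply: pl; ring.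
have pL i : `|left_pot E s i - left_pot E' s' i| <= 8 * `|s - s'| + `|E - E'|.
  by apply: pl; ring.
have H1 := @cfrac_err E s E' s' k (right_pot E s) (right_pot E' s')
  (fun i ik => (right_pot_ge nr ik).2) (fun i ik => (right_pot_ge nr' ik).2)
  (fun i _ => pR i).
have H2 := @cfrac_err E s E' s' k.-1 (left_pot E s) (left_pot E' s')
  (fun i ik => le_trans (left_pot_ge nr ik).2 (ler_norm _))
  (fun i ik => le_trans (left_pot_ge nr' ik).2 (ler_norm _))
  (fun i _ => pL i).
set x := _ - lam * cfrac lam (right_pot E' s') k in H1.
set y := _ - lam * cfrac lam (left_pot E' s') k.-1 in H2.
have -> : eff_diag E s - eff_diag E' s' - (dual_pot E (h * k%:R + s) - dual_pot E' (h * k%:R + s'))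
  = x + y by rewrite /eff_diag /x /y; ring.
by apply: le_trans (ler_normD _ _) _; lra.
Qed.

(** By the product formula, where one sine is of order [s] and the other one is at
    least [h], since its phase stays at distance [h / 2] from [0] and from [1]. *)
Local Lemma cos_slope s : 0 <= s <= z ->
  4 * h * s <= res_energy - 2 * cos (pi * (h * k%:R + s)) /\
  4 * h * s <= 2 * cos (pi * (h * k%:R - s)) - res_energy.
Proof.
move=> /andP[s0 sz]; have hp := h_gt0; have zh := sc_zh Sc; have zy := sc_zy Sc.
have hk : h <= h * k%:R by rewrite ler_peMr ?ler1n ?(sc_k Sc)// ltW.
have s1 : s <= sin (pi * (s / 2)).
  apply: le_trans (_ : 2 * (s / 2) <= _); first lra.
  by apply: sin_jordan; have := sc_z4 Sc; lra.
have H u : h / 2 <= u -> h / 2 <= 1 - u -> h * s <= sin (pi * u) * sin (pi * (s / 2)).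
  move=> u1 u2; apply: ler_pM => //; first exact: ltW.
  by apply: le_trans (_ : 2 * (h / 2) <= _); [lra|apply: sin_jordan2; lra].
rewrite /res_energy -!mulrBr !cosBcos; split.
  have -> : (pi * (h * k%:R) + pi * (h * k%:R + s)) / 2 = pi * (h * k%:R + s / 2)
    by field.
  have -> : (pi * (h * k%:R) - pi * (h * k%:R + s)) / 2 = - (pi * (s / 2)) by field.
  by have := H (h * k%:R + s / 2); rewrite sinN; lra.
have -> : (pi * (h * k%:R - s) + pi * (h * k%:R)) / 2 = pi * (h * k%:R - s / 2)
  by field.
have -> : (pi * (h * k%:R - s) - pi * (h * k%:R)) / 2 = - (pi * (s / 2)) by field.
by have := H (h * k%:R - s / 2); rewrite sinN; lra.
Qed.

Local Lemma cos_slope_norm s : `|s| <= z ->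
  4 * h * `|s| <= `|2 * cos (pi * (h * k%:R + s)) - res_energy|.
Proof.
move=> sz; case: (leP 0 s) sz => s0.
  rewrite (ger0_norm s0) => sz; rewrite distrC; apply: le_trans (ler_norm _).
  by apply: (cos_slope _).1; rewrite s0.
rewrite (ltr0_norm s0) => sz; apply: le_trans (ler_norm _).
rewrite -{2}[s]opprK; apply: (cos_slope _).2; lra.
Qed.

Local Lemma chain_small E s : near_res E s ->
  `|eff_diag E s - dual_pot E (h * k%:R + s)| <= 2 * lam.
Proof.
move=> nr; have l0 := sc_l0 Sc.
have H1 : `|lam * cfrac lam (right_pot E s) k| <= lam.
  rewrite normrM gtr0_norm//; apply: ler_piMr; first exact: ltW.
  by apply: cfrac_le1 => // i; exact: lam_right_pot.
have H2 : `|lam * cfrac lam (left_pot E s) k.-1| <= lam.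
  rewrite normrM gtr0_norm//; apply: ler_piMr; first exact: ltW.
  by apply: cfrac_le1 => // i ik; apply: le_trans (ler_norm _); exact: lam_left_pot.
have -> : eff_diag E s - dual_pot E (h * k%:R + s) =
  lam * cfrac lam (right_pot E s) k + lam * cfrac lam (left_pot E s) k.-1
    by rewrite /eff_diag; ring.
by apply: le_trans (ler_normD _ _) _; lra.
Qed.

(** The effective diagonal differs by at most [2 lam] from [res_energy - E], which
    changes sign while the phase of [E] moves by [z^14] on either side of [h k]. *)
Lemma gap_center : exists2 r : R, 2 * h * `|r| <= lam & `|r| <= z ^+ 14 /\
  eff_diag (2 * cos (pi * (h * k%:R + r))) 0 = 0.
Proof.
have l0 := sc_l0 Sc; have z0 := sc_z0 Sc; have hp := h_gt0; have zh := sc_zh Sc.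
pose Er r := 2 * cos (pi * (h * k%:R + r)).
have zw : z ^+ 14 <= z.
  by have : z ^+ 14 <= z ^+ 1 / 4 ^+ 13 := zXD_le 1 13; rewrite expr1; lra.
have EL r r' : `|Er r - Er r'| <= 8 * `|r - r'|.
  rewrite /Er -mulrBr normrM ger0_norm//.
  have := cospi_lip (h * k%:R + r) (h * k%:R + r').
  by rewrite (_ : _ - (h * k%:R + r') = r - r'); [lra|ring].
have E0 : Er 0 = res_energy by rewrite /Er addr0.
have nrE r : - z ^+ 14 <= r <= z ^+ 14 -> near_res (Er r) 0.
  move=> rw; split; first by rewrite normr0 ltW ?zX_gt0.
  rewrite -E0; apply: le_trans (EL _ _) _; rewrite subr0.
  have : `|r| <= z ^+ 14 by rewrite ler_norml.
  have : z ^+ 14 <= z ^+ 12 / 4 ^+ 2 := zXD_le 12 2.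
  by have := zX_gt0 12; lra.
have small r : near_res (Er r) 0 -> `|eff_diag (Er r) 0 - (res_energy - Er r)| <= 2 * lam.
  by move=> /chain_small; rewrite /dual_pot addr0.
have h13 : lam <= h * z ^+ 14.
  apply: le_trans (@lam_le_zX 15 0 isT) _; rewrite expr0 divr1 exprS.
  by apply: ler_wpM2r => //; exact/ltW/zX_gt0.
have [||||r rw r0] := @lip_IVT R (fun r => - eff_diag (Er r) 0) (- z ^+ 14) (z ^+ 14) 16.
- by have := zX_gt0 14; lra.
- by [].
- move=> x y xw yw; have := eff_diag_lip (nrE _ xw) (nrE _ yw).
  rewrite /dual_pot subrr normr0 mulr0 add0r.
  have := EL x y; set a := eff_diag _ _; set b := eff_diag _ _.
  have -> : 2 * cos (pi * (h * k%:R + 0)) - Er x - (2 * cos (pi * (h * k%:R + 0)) - Er y)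
    = - (Er x - Er y) by ring.
  have z8 : z ^+ 8 <= 1 by have : z ^+ 8 <= z ^+ 0 / 4 ^+ 8 := zXD_le 0 8; rewrite expr0; lra.
  rewrite opprK => h1 h2.
  have h3 : z ^+ 8 * `|Er x - Er y| <= `|Er x - Er y| by rewrite ler_piMl.
  have -> : - a - - b = - ((a - b + (Er x - Er y)) - (Er x - Er y)) by ring.
  rewrite normrN; apply: le_trans (ler_normB _ _) _; lra.
- have w0 : 0 <= z ^+ 14 <= z by rewrite ltW ?zX_gt0.
  have [s1 s2] := cos_slope w0.
  have n1 : near_res (Er (z ^+ 14)) 0 by apply: nrE; have := zX_gt0 14; lra.
  have n2 : near_res (Er (- z ^+ 14)) 0 by apply: nrE; have := zX_gt0 14; lra.
  have := small _ n1; have := small _ n2.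
  rewrite !ler_norml => /andP[a1 a2] /andP[b1 b2].
  rewrite -/(Er _) in s1; rewrite -/(Er _) in s2.
  apply/andP; split; lra.
have rz : `|r| <= z ^+ 14 by rewrite ler_norml.
have {}r0 : eff_diag (Er r) 0 = 0 by move/eqP: r0; rewrite oppr_eq0 => /eqP.
exists r => //.
have := small _ (nrE _ rw); rewrite r0 sub0r normrN distrC => H.
have := @cos_slope_norm r (le_trans rz zw); rewrite -/(Er r); lra.
Qed.

Context (E0 : R) (E0c : eff_diag E0 0 = 0) (E0near : `|E0 - res_energy| <= z ^+ 13).

(** If [s] is so small that the linear term could be compared with the tunnelling
    term, the two effective diagonals add up to [- 2 (E - E0)] plus
    errors that are quadratic in [s] or damped by [z^8], and the off-diagonal
    criterion applies.  For larger
    [s] both diagonal entries are of order [h s], far above the tunnelling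
    term. *)
Local Lemma pair_solve (E s x y e : R) : near_res E s ->
  `|E - E0| < half_gap / 2 ->
  `|eff_diag E s * x + tunnel E s * y| <= e ->
  `|eff_diag E (- s) * y + tunnel E (- s) * x| <= e -> `|x| <= 16 / half_gap * e.
Proof.
move=> nr EE he1 he2; have t0 := half_gap_gt0; have nrN := near_resN nr.
have z0 := sc_z0 Sc; have z4 := sc_z4 Sc.
have nr0 : near_res E0 0.
  split; first by rewrite normr0 ltW ?zX_gt0.
  by apply: le_trans E0near _; have := zXS_le 12; have := zX_gt0 12; lra.
have S1 := eff_diag_lip nr nr0; have S2 := eff_diag_lip nrN nr0.
rewrite E0c !subr0 normrN in S1 S2.
set D1 := dual_pot E (h * k%:R + s) - _ in S1.
set D2 := dual_pot E (h * k%:R - s) - _ in S2.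
have D1E : D1 = 2 * cos (pi * (h * k%:R + s)) - res_energy - (E - E0).
  by rewrite /D1 /dual_pot addr0 /res_energy; ring.
have D2E : D2 = 2 * cos (pi * (h * k%:R - s)) - res_energy - (E - E0).
  by rewrite /D2 /dual_pot addr0 /res_energy; ring.
have z8 : z ^+ 8 <= z / 4 ^+ 7 := zXD_le 1 7.
have EE8 : z ^+ 8 * `|E - E0| <= 1 / 4 ^+ 7 * `|E - E0| by apply: ler_wpM2r => //; lra.
have tz : half_gap <= z ^+ 12 / 4 ^+ 7 := @half_gap_z 12 7 isT.
(* Up to powers of [z], both criteria hold for [s] between [half_gap] and
   [sqrt half_gap]; the threshold [half_gap / z^4] lies in this range. *)
case: (leP (`|s| * z ^+ 4) half_gap) => sz.
- have s8 : `|s| <= z ^+ 8 / 4 ^+ 7.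
    rewrite -(ler_pM2r (zX_gt0 4)); apply: le_trans sz _; apply: le_trans tz _.
    by rewrite [leRHS]mulrAC -exprD.
  have ss : `|s| ^+ 2 <= half_gap / 4 ^+ 7.
    rewrite expr2; apply: le_trans (_ : `|s| * (z ^+ 4 * (z ^+ 4 / 4 ^+ 7)) <= _).
      by apply: ler_wpM2l => //; apply: le_trans s8 _; rewrite [leRHS]mulrA -exprD.
    apply: le_trans (_ : half_gap * (z ^+ 4 / 4 ^+ 7) <= _).
      rewrite (mulrA `|s|) (ler_wpM2r _ sz)//.
      by rewrite divr_ge0 ?exprn_ge0// ltW.
    apply: ler_wpM2l; first exact: ltW.
    have : z ^+ 4 <= z ^+ 0 / 4 ^+ 4 := zXD_le 0 4; rewrite expr0; lra.
  have small : 8 * `|s| + `|E - res_energy| + lam <= z ^+ 3 * (z / 2).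
    rewrite mulrA -exprSr; have := nr.2; have : lam <= z ^+ 4 / 4 ^+ 3 := @lam_le_zX 4 3 isT.
    have : z ^+ 12 <= z ^+ 4 / 4 ^+ 8 := zXD_le 4 8.
    have : z ^+ 8 <= z ^+ 4 / 4 ^+ 4 := zXD_le 4 4.
    have := zX_gt0 4; lra.
  apply: (@two_by_two_offdiag _ half_gap ((-1) ^+ k.-1) (eff_diag E s) (eff_diag E (- s))
    (tunnel E s) (tunnel E (- s)) x y e t0) => //.
  + by rewrite normrX normrN1 expr1n.
  + exact: tunnel_lb.
  + by apply: tunnel_lb => //; rewrite normrN.
  have -> : eff_diag E s + eff_diag E (- s) =
      (eff_diag E s - D1) + (eff_diag E (- s) - D2) + (D1 + D2).
    by ring.
  have DD : `|D1 + D2| <= 32 * `|s| ^+ 2 + 2 * `|E - E0|.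
    have -> : D1 + D2 = 4 * cos (pi * (h * k%:R)) * (cos (pi * s) - cos 0) - 2 * (E - E0).
      rewrite D1E D2E /res_energy mulrDr mulrBr cosD cosB cos0; ring.
    apply: le_trans (ler_normB _ _) _; rewrite [`|2 * _|]normrM [`|2|]ger0_norm// lerD2r.
    rewrite !normrM [`|4|]ger0_norm// cosBcos addr0 subr0 !normrM normrN [`|2|]ger0_norm//.
    have q : `|sin (pi * s / 2)| <= 2 * `|s|.
      have := sin_lip (pi * s / 2) 0; rewrite sin0 !subr0 => H; apply: le_trans H _.
      rewrite !normrM (ger0_norm (@pi_ge0 R)) [`|2^-1|]ger0_norm//.
      by have := ler_wpM2r (normr_ge0 s) (@pi_le4 R); lra.
    have q2 : `|sin (pi * s / 2)| * `|sin (pi * s / 2)| <= (2 * `|s|) * (2 * `|s|).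
      exact: ler_pM.
    have c1 := cos_max (pi * (h * k%:R)).
    have := ler_wpM2r (mulr_ge0 (normr_ge0 (sin (pi * s / 2))) (normr_ge0 (sin (pi * s / 2)))) c1.
    rewrite expr2; lra.
  apply: le_trans (ler_normD _ _) _.
  apply: le_trans (lerD (ler_normD _ _) (lexx _)) _.
  have s9 : z ^+ 8 * `|s| <= half_gap / 4 ^+ 4.
    have -> : z ^+ 8 * `|s| = (`|s| * z ^+ 4) * z ^+ 4 by ring.
    apply: ler_pM => //; [by rewrite mulr_ge0// ltW ?zX_gt0|exact/ltW/zX_gt0|].
    have : z ^+ 4 <= z ^+ 0 / 4 ^+ 4 := zXD_le 0 4; rewrite expr0; lra.
  by lra.
- have zs : `|s| <= z.
    apply: le_trans nr.1 _; have : z ^+ 6 <= z ^+ 1 / 4 ^+ 5 := zXD_le 1 5; rewrite expr1; lra.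
  have hs : z * `|s| <= h * `|s| by apply: ler_wpM2r => //; exact: sc_zh Sc.
  have z3s : z ^+ 3 * `|s| <= z * `|s| / 16.
    have -> : z * `|s| / 16 = z / 16 * `|s| by ring.
    apply: ler_wpM2r => //; have : z ^+ 3 <= z ^+ 1 / 4 ^+ 2 := zXD_le 1 2.
    by rewrite expr1; lra.
  have ts : half_gap <= z ^+ 3 * `|s| / 4.
    have -> : z ^+ 3 * `|s| / 4 = `|s| * (z ^+ 3 / 4) by ring.
    by apply: le_trans (ltW sz) _; apply: ler_wpM2l => //; exact: zXS_le.
  have tun (T : R) : `|T| <= 2 ^+ k.-1 * half_gap -> 2 * `|T| <= h * `|s|.
    move=> hT; apply: le_trans (_ : 2 ^+ k * half_gap <= _).
      by rewrite -(prednK (sc_k Sc)) exprS -mulrA ler_pM2l.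
    have z2 : 2 ^+ k * z <= 1.
      apply: le_trans (sc_z4k Sc); rewrite mulrC; apply: ler_wpM2l; first exact: ltW.
      by apply: lerXn2r; rewrite ?nnegrE; lra.
    apply: le_trans (_ : 2 ^+ k * (`|s| * z ^+ 4) <= _).
      by apply: ler_wpM2l; [rewrite exprn_ge0|exact: ltW].
    have -> : 2 ^+ k * (`|s| * z ^+ 4) = (2 ^+ k * z) * (z ^+ 3 * `|s|) by ring.
    apply: le_trans (_ : 1 * (z ^+ 3 * `|s|) <= _).
      by apply: ler_wpM2r => //; rewrite mulr_ge0// ltW ?zX_gt0.
    have : 0 <= z * `|s| by rewrite mulr_ge0// ltW.
    lra.
  have F (s' f D : R) : `|s'| = `|s| ->
      D = 2 * cos (pi * (h * k%:R + s')) - res_energy - (E - E0) ->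
      `|f - D| <= z ^+ 8 * (8 * `|s| + `|E - E0|) -> 2 * h * `|s| <= `|f|.
    move=> s's DE fD.
    have := @cos_slope_norm s'; rewrite s's => /(_ zs) sl.
    have d1 : 4 * h * `|s| - `|E - E0| <= `|D|.
      rewrite DE; have := lerB_dist (2 * cos (pi * (h * k%:R + s')) - res_energy) (E - E0); lra.
    have d2 : `|D| - `|f - D| <= `|f|.
      by have := ler_normB f (f - D); rewrite (_ : f - (f - D) = D); [lra|ring].
    have s8 : z ^+ 8 * `|s| <= z * `|s| / 4 ^+ 7.
      have -> : z * `|s| / 4 ^+ 7 = z / 4 ^+ 7 * `|s| by ring.
      exact: ler_wpM2r.
    have : 0 <= z * `|s| by rewrite mulr_ge0// ltW.
    by lra.
  have F1 := F _ _ _ erefl D1E S1.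
  have F2 := F _ _ _ (normrN s) D2E S2.
  have zs0 : 0 <= z * `|s| by rewrite mulr_ge0// ltW.
  apply: (@two_by_two_diag _ half_gap (eff_diag E s) (eff_diag E (- s))
    (tunnel E s) (tunnel E (- s)) x y e t0) => //; try lra.
  + by have := tun _ (tunnel_ub nr); lra.
  + by have := tun _ (tunnel_ub nrN); lra.
Qed.

(** The equation at the partner site is the equation at a resonant site of phase
    [h k - s] for the reflected sequence [w (- k - j)]. *)
Local Lemma res_estimate (E s : R) (w : int -> R) (G V : R) : near_res E s ->
  `|E - E0| < half_gap / 2 ->
  (forall j : int, `|j| <= (2 * k)%:Z -> `|dual_res E s w j| <= G) ->
  `|w k.+1%:Z| <= V -> `|w (- (2 * k).+1%:Z)| <= V ->
  `|w 0| <= 16 / half_gap * ((2 * k)%:R * G) + 16 * z ^+ 12 * V.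
Proof.
move=> nr EE hG v1 v2; have t0 := half_gap_gt0.
have V0 : 0 <= V by apply: le_trans v1.
have H1 : `|eff_diag E s * w 0 + tunnel E s * w (- k%:Z)|
    <= (2 * k)%:R * G + z ^+ 12 * half_gap * V.
  have kk : k%:Z <= (2 * k)%:Z by rewrite lez_nat mul2n -addnn leq_addr.
  have H := @site_elim E s w G nr (fun j hj => hG j (le_trans hj kk)).
  set a := _ + _; have -> : a = a + leak E s * w k.+1%:Z - leak E s * w k.+1%:Z by ring.
  apply: le_trans (ler_normB _ _) _; apply: lerD => //.
  by rewrite normrM; apply: ler_pM => //; exact: leak_ub.
pose w' j := w (- k%:Z - j).
have dualN j : dual_res E (- s) w' j = dual_res E s w (- k%:Z - j).
  rewrite /dual_res /w' addrC [RHS]addrC; congr (_ * _ + _ * _).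
    rewrite /dual_pot -[in LHS]cosN; congr (2 * cos _ - _).
    by rewrite intrD !mulrNz -pmulrn; ring.
  by rewrite addrC; congr (w _ + w _); ring.
have H2 : `|eff_diag E (- s) * w (- k%:Z) + tunnel E (- s) * w 0|
    <= (2 * k)%:R * G + z ^+ 12 * half_gap * V.
  have H := @site_elim E (- s) w' G (near_resN nr) _.
  set a := _ + _.
  have aE : a = eff_diag E (- s) * w' 0 + tunnel E (- s) * w' (- k%:Z).
    by rewrite /a /w' subr0 subrr.
  have -> : a = a + leak E (- s) * w' k.+1%:Z - leak E (- s) * w' k.+1%:Z by ring.
  apply: le_trans (ler_normB _ _) _; apply: lerD.
    rewrite aE; apply: H => j hj; rewrite dualN; apply: hG.
    apply: le_trans (ler_normB _ _) _; rewrite normrN mul2n -addnn PoszD.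
    by rewrite lerD// ger0_norm.
  rewrite normrM; apply: ler_pM => //; first exact/leak_ub/near_resN.
  rewrite /w' (_ : - k%:Z - k.+1%:Z = - (2 * k).+1%:Z)//.
  by rewrite -opprD -PoszD addnS addnn -mul2n.
apply: le_trans (pair_solve nr EE H1 H2) _.
rewrite mulrDr lerD2l le_eqVlt; apply/orP; left; apply/eqP.
by field; rewrite gt_eqF.
Qed.

Definition dual_op (E th : R) (v : int -> R) (m : int) : R :=
  lam * (v (m + 1) + v (m - 1)) + dual_pot E (2 * h * m%:~R + th) * v m.

Local Lemma cos_red (t : R) (n : int) : cos (pi * (2 * n%:~R + t)) = cos (pi * t).
Proof. by rewrite mulrDr addrC cosDpi2z. Qed.

(** The two factors in the product formula for the difference of cosines are
    bounded below by the distances of [t] to [h k] and to [- h k], modulo 2. *)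
Local Lemma nonres_pot (E t : R) : 0 <= t <= 1 -> z ^+ 6 < `|t - h * k%:R| ->
  `|E - res_energy| <= z ^+ 12 -> z ^+ 12 <= `|dual_pot E t|.
Proof.
move=> /andP[t0 t1] far EE; have hp := h_gt0; have yk := sc_zy Sc; have z0 := sc_z0 Sc.
have hk0 : 0 <= h * k%:R by rewrite mulr_ge0// ltW.
have z6 : z ^+ 6 <= 1 / 4 ^+ 6.
  by have : z ^+ 6 <= z ^+ 0 / 4 ^+ 6 := zXD_le 0 6; rewrite expr0.
have zp6 := zX_gt0 6; have zp12 := zX_gt0 12.
have tb : `|t - h * k%:R| <= t + h * k%:R.
  by rewrite ler_norml; apply/andP; split; lra.
have tb1 : `|t - h * k%:R| <= 1.
  by rewrite ler_norml; apply/andP; split; lra.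
have s1 : z ^+ 6 <= sin (pi * ((t + h * k%:R) / 2)).
  by apply: le_trans (_ : 2 * (z ^+ 6 / 2) <= _); [lra|apply: sin_jordan2; lra].
have s2 : z ^+ 6 <= `|sin (pi * ((t - h * k%:R) / 2))|.
  have -> : `|sin (pi * ((t - h * k%:R) / 2))| = `|sin (pi * (`|t - h * k%:R| / 2))|.
    case: (leP 0 (t - h * k%:R)) => ht; first by rewrite (ger0_norm ht).
    by rewrite (ltr0_norm ht) mulNr mulrN sinN normrN.
  apply: le_trans (ler_norm _).
  by apply: le_trans (_ : 2 * (z ^+ 6 / 2) <= _); [lra|apply: sin_jordan2; lra].
have big : 4 * z ^+ 12 <= `|2 * cos (pi * t) - res_energy|.
  rewrite /res_energy -mulrBr cosBcos.
  have -> : (pi * t + pi * (h * k%:R)) / 2 = pi * ((t + h * k%:R) / 2) by field.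
  have -> : (pi * t - pi * (h * k%:R)) / 2 = pi * ((t - h * k%:R) / 2) by field.
  rewrite !normrM normrN ger0_norm// mulrA [2 * (2 * _)]mulrA -natrM -mulrA.
  rewrite (exprD z 6 6); apply: ler_wpM2l => //; apply: ler_pM => //; [exact: ltW|exact: ltW|].
  exact: le_trans s1 (ler_norm _).
rewrite /dual_pot.
have -> : 2 * cos (pi * t) - E = 2 * cos (pi * t) - res_energy - (E - res_energy) by ring.
by apply: le_trans (lerB_dist _ _); lra.
Qed.

(** At a nonresonant site the diagonal alone controls [v m]; at a resonant one the
    two by two system does.  Reflection of the lattice reduces phases near [- h k]
    to phases near [h k].  The small factor [z^2] in front of the values at the
    neighbouring sites is what allows them to be absorbed globally. *)
Lemma dual_local (E : R) : `|E - E0| < half_gap / 2 ->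
  exists2 A : R, 0 <= A & forall (th : R) (v : int -> R) (m : int) (G V : R),
    (forall j : int, `|j| <= (2 * k).+1%:Z -> `|dual_op E th v (m + j)| <= G) ->
    (forall j : int, `|j| <= (2 * k).+1%:Z -> `|v (m + j)| <= V) ->
    `|v m| <= A * G + z ^+ 2 * V.
Proof.
move=> EE; have t0 := half_gap_gt0; have l0 := sc_l0 Sc; have zp12 := zX_gt0 12.
have tz : half_gap <= z ^+ 12 / 4 ^+ 7 := @half_gap_z 12 7 isT.
have Es : `|E - res_energy| <= z ^+ 12.
  have -> : E - res_energy = (E - E0) + (E0 - res_energy) by ring.
  apply: le_trans (ler_normD _ _) _.
  have h13 : z ^+ 13 <= z ^+ 12 / 4 := zXS_le 12.
  have := ltW EE; have := E0near; lra.
have A1 : 0 <= 16 / half_gap * (2 * k)%:R by rewrite mulr_ge0// divr_ge0// ltW.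
have A2 : 0 <= (z ^+ 12)^-1 by rewrite invr_ge0 ltW.
exists (16 / half_gap * (2 * k)%:R + (z ^+ 12)^-1); first exact: addr_ge0.
move=> th v m G V hG hV.
have G0 : 0 <= G by apply: le_trans (hG 0 _).
have V0 : 0 <= V by apply: le_trans (hV 0 _).
have [n [t' [t01 tE]]] := angle_reduce (2 * h * m%:~R + th).
case: (leP `|t' - h * k%:R| (z ^+ 6)) => near; last first.
  have pE : dual_pot E (2 * h * m%:~R + th) = dual_pot E t'.
    by case: tE => ->; rewrite /dual_pot cos_red ?mulrN ?cosN.
  have P := nonres_pot t01 near Es; rewrite -pE in P.
  have := hG 0 isT; rewrite addr0 /dual_op; set p := dual_pot _ _ in P *.
  set q := lam * _ => hg.
  have hq : `|q| <= 2 * lam * V.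
    rewrite /q normrM gtr0_norm// mulrAC mulrC; apply: ler_wpM2r; first exact: ltW.
    apply: le_trans (ler_normD _ _) _.
    by have := hV 1 isT; have := hV (- 1%:Z) isT; lra.
  have pv : `|v m| * z ^+ 12 <= G + 2 * lam * V.
    apply: le_trans (_ : `|p * v m| <= _).
      by rewrite normrM mulrC; apply: ler_wpM2r.
    have -> : p * v m = (q + p * v m) - q by ring.
    by apply: le_trans (ler_normB _ _) _; lra.
  have lz : 2 * lam * V <= z ^+ 2 * V * z ^+ 12.
    rewrite [leRHS]mulrAC; apply: ler_wpM2r => //.
    by have := @lam_le_zX 14 1 isT; rewrite -exprD; lra.
  apply: le_trans (_ : (z ^+ 12)^-1 * G + z ^+ 2 * V <= _).
    rewrite -(ler_pM2r zp12) mulrDl mulrAC mulVf ?gt_eqF// mul1r; lra.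
  by rewrite lerD2r; apply: ler_wpM2r => //; lra.
have nr : near_res E (t' - h * k%:R) by split.
have res (w : int -> R) : w 0 = v m ->
   (forall j, `|j| <= (2 * k).+1%:Z -> exists2 i : int, `|i| <= (2 * k).+1%:Z &
      w j = v (m + i) /\ dual_res E (t' - h * k%:R) w j = dual_op E th v (m + i)) ->
   `|v m| <= (16 / half_gap * (2 * k)%:R + (z ^+ 12)^-1) * G + z ^+ 2 * V.
  move=> w0 hw; rewrite -w0.
  have hv j : `|j| <= (2 * k).+1%:Z -> `|w j| <= V.
    by move=> /hw[i hi [-> _]]; exact: hV.
  apply: le_trans (@res_estimate E _ w G V nr EE _ _ _) _.
  - move=> j hj; have [|i hi [_ ->]] := hw j; last exact: hG.
    by apply: le_trans hj _; rewrite lez_nat leqnSn.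
  - by apply: hv; rewrite ger0_norm// lez_nat ltnS leq_pmull.
  - by apply: hv; rewrite normrN ger0_norm.
  apply: lerD; first by rewrite mulrA [leRHS]mulrDl lerDl mulr_ge0.
  apply: ler_wpM2r => //; have : z ^+ 12 <= z ^+ 2 / 4 ^+ 10 := zXD_le 2 10.
  have := zX_gt0 2; lra.
case: tE => tE.
  apply: (res (fun j => v (m + j))); first by rewrite addr0.
  move=> j hj; exists j => //; split=> //.
  rewrite /dual_res /dual_op !addrA; congr (_ + _ * _); rewrite /dual_pot; congr (2 * _ - _).
  rewrite -(cos_red _ n); congr (cos (pi * _)).
  by rewrite intrD; move: tE; lra.
apply: (res (fun j => v (m - j))); first by rewrite subr0.
move=> j hj; exists (- j); first by rewrite normrN.
split=> //.
rewrite /dual_res /dual_op; congr (_ * _ + _ * _).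
  by rewrite addrC; congr (v _ + v _); ring.
rewrite /dual_pot; congr (2 * _ - _).
set u := h * k%:R + _ + _.
have -> : cos (pi * u) = cos (pi * (2 * n%:~R - u)) by rewrite cos_red mulrN cosN.
congr (cos (pi * _)).
by rewrite /u intrD mulrNz; move: tE; lra.
Qed.

End Resonance.

(** * From local bounds to square sums *)

Definition jac (R : pzRingType) (b : R) (V u : nat -> R) (n : nat) : R :=
  b * (u n + u n.+2) + V n.+1 * u n.+1.

(** For a sequence that vanishes at [0] and [1], the value [jac b V u n] at the
    site [n+1] runs over the whole image: no boundary term is lost. *)
Definition fin_coercive (R : numDomainType) (b : R) (V : nat -> R) (d : R) :=
  forall (u : nat -> R) (N : nat), u 0%N = 0 -> u 1%N = 0 ->
    (forall n, (N <= n)%N -> u n = 0) ->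
    d * \sum_(n < N) u n.+1 ^+ 2 <= \sum_(n < N) jac b V u n ^+ 2.

Lemma sum_supp_le (R : numDomainType) (f : nat -> R) (Q P : nat) :
  (forall n, 0 <= f n) -> (forall n, (Q <= n)%N -> f n = 0) ->
  \sum_(n < P) f n <= \sum_(n < Q) f n.
Proof.
move=> f0 fQ; elim: P => [|P IH]; first by rewrite big_ord0 sumr_ge0.
case: (leqP Q P) => QP; first by rewrite big_ord_recr /= fQ// addr0.
rewrite -!(big_mkord xpredT f) [leRHS](big_cat_nat (n := P.+1)) //=.
by rewrite lerDl sumr_ge0.
Qed.

Lemma sum_shiftz_le (R : numDomainType) (f : int -> R) (Q P : nat) (s : int) :
  (forall n, 0 <= f n) -> (forall n : nat, (Q <= n)%N -> f n%:Z = 0) ->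
  (forall n, f (Negz n) = 0) ->
  \sum_(m < P) f (m%:Z + s) <= \sum_(n < Q) f n%:Z.
Proof.
move=> f0 fQ fN; have g0 (n : nat) : 0 <= f n%:Z by exact: f0.
case: s => a.
  apply: le_trans (sum_supp_le (P + a) g0 fQ).
  rewrite -(big_mkord xpredT (fun m : nat => f (m%:Z + a%:Z))).
  rewrite -(big_mkord xpredT (fun m : nat => f m%:Z)).
  have -> : \sum_(0 <= m < P) f (m%:Z + a%:Z) = \sum_(a <= m < P + a) f m%:Z.
    rewrite -[X in _ = \sum_(X <= m < _) _]add0n big_addn addnK; apply: eq_bigr => m _.
    by rewrite PoszD.
  by rewrite [leRHS](big_cat_nat (n := a)) ?leq_addl//= lerDr sumr_ge0.
apply: le_trans (sum_supp_le P g0 fQ).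
rewrite NegzE; elim: a.+1 P => {a} [|a IH] P.
  by apply: ler_sum => m _; rewrite oppr0 addr0.
case: P => [|P]; first by rewrite !big_ord0.
rewrite big_ord_recl [leRHS]big_ord_recr /= add0r -NegzE fN add0r.
apply: le_trans (_ : \sum_(m < P) f (m%:Z - a%:Z) <= _).
  apply: ler_sum => m _; rewrite /bump /= add1n.
  by rewrite (_ : m.+1%:Z - a.+1%:Z = m%:Z - a%:Z)//; lia.
by apply: le_trans (IH P) _; rewrite lerDl.
Qed.

Lemma sqr_sum_le (R : realFieldType) (n : nat) (a : nat -> R) :
  (\sum_(i < n) a i) ^+ 2 <= n%:R * \sum_(i < n) a i ^+ 2.
Proof.
elim: n => [|[|n] IH]; first by rewrite !big_ord0 expr0n mulr0.
  by rewrite !big_ord_recr !big_ord0 /= !add0r mul1r.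
rewrite [\sum_(i < n.+2) a i]big_ord_recr [\sum_(i < n.+2) _ ^+ 2]big_ord_recr /=.
set S := \sum_(i < n.+1) a i in IH *; set T := \sum_(i < n.+1) _ in IH *.
have n0 : 0 < n.+1%:R :> R by rewrite ltr0n.
have cs : 2 * S * a n.+1 <= S ^+ 2 / n.+1%:R + n.+1%:R * a n.+1 ^+ 2.
  rewrite -(ler_pM2r n0) [leRHS]mulrDl divfK ?gt_eqF//.
  have : 0 <= (S - n.+1%:R * a n.+1) ^+ 2 by exact: sqr_ge0.
  by rewrite sqrrB; lra.
have S2 : S ^+ 2 / n.+1%:R <= T by rewrite ler_pdivrMr// mulrC.
rewrite -[n.+2%:R]natr1 sqrrD mulr2n; move: IH S2 cs.
set m := n.+1%:R; set q := S ^+ 2 / m; set b := a n.+1.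
have -> : (m + 1) * (T + b ^+ 2) = m * T + T + m * b ^+ 2 + b ^+ 2 by ring.
lra.
Qed.

(** Square the local bound, with the suprema over a window replaced by sums, and
    sum over all sites: every site lies in as many windows as a window has sites,
    so the term in [v] comes back with a factor [1/2] and is absorbed. *)
Lemma local_to_l2 (R : realFieldType) (M : nat) (A kap : R) (v g : int -> R) (Q : nat) :
  0 <= A -> 0 <= kap -> kap * (2 * M).+1%:R <= 1 / 2 ->
  (forall n : nat, (Q <= n)%N -> v n%:Z = 0 /\ g n%:Z = 0) ->
  (forall n, v (Negz n) = 0 /\ g (Negz n) = 0) ->
  (forall (m : int) (G V : R),
     (forall j : int, `|j| <= M%:Z -> `|g (m + j)| <= G) ->
     (forall j : int, `|j| <= M%:Z -> `|v (m + j)| <= V) ->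
     `|v m| <= A * G + kap * V) ->
  \sum_(m < Q) v m%:Z ^+ 2
    <= 4 * (A * (2 * M).+1%:R) ^+ 2 * \sum_(m < Q) g m%:Z ^+ 2.
Proof.
move=> A0 k0 kM vg0 vgN loc; set W := (2 * M).+1 in kM *.
have W0 : 0 <= W%:R :> R by [].
pose win (f : int -> R) (m : int) : R := \sum_(i < W) `|f (m + (i%:Z - M%:Z))|.
have winP f m (j : int) : `|j| <= M%:Z -> `|f (m + j)| <= win f m.
  move=> jM; have iW : (absz (j + M%:Z)%R < W)%N by rewrite /W; lia.
  rewrite /win (bigD1 (Ordinal iW)) //=.
  have -> : (absz (j + M%:Z)%R)%:Z - M%:Z = j by lia.
  by rewrite lerDl sumr_ge0.
pose win2 (f : int -> R) (m : int) : R := \sum_(i < W) f (m + (i%:Z - M%:Z)) ^+ 2.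
have winle f m : win f m ^+ 2 <= W%:R * win2 f m.
  apply: le_trans (sqr_sum_le W (fun i => `|f (m + (i%:Z - M%:Z))|)) _.
  rewrite ler_wpM2l// ler_sum// => i _.
  by rewrite real_normK ?num_real.
have win0 f m : 0 <= win f m by apply: sumr_ge0.
have pt (m : nat) : v m%:Z ^+ 2 <= 2 * A ^+ 2 * W%:R * win2 g m%:Z
    + 2 * kap ^+ 2 * W%:R * win2 v m%:Z.
  have h1 := loc m%:Z _ _ (winP g m%:Z) (winP v m%:Z).
  set a := A * _ in h1; set c := kap * _ in h1.
  have a0 : 0 <= a by rewrite mulr_ge0.
  have c0 : 0 <= c by rewrite mulr_ge0.
  apply: le_trans (_ : 2 * a ^+ 2 + 2 * c ^+ 2 <= _).
    apply: le_trans (_ : (a + c) ^+ 2 <= _).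
      rewrite -[v _ ^+ 2]real_normK ?num_real//.
      by apply: lerXn2r => //; rewrite nnegrE ?addr_ge0.
    have : 0 <= (a - c) ^+ 2 by exact: sqr_ge0.
    by rewrite sqrrB sqrrD; lra.
  rewrite /a /c !exprMn; apply: lerD.
    have := ler_wpM2l (mulr_ge0 (ler0n R 2) (sqr_ge0 A)) (winle g m%:Z).
    by rewrite !mulrA.
  have := ler_wpM2l (mulr_ge0 (ler0n R 2) (sqr_ge0 kap)) (winle v m%:Z).
  by rewrite !mulrA.
have tot f : (forall n : nat, (Q <= n)%N -> f n%:Z = 0) ->
    (forall n, f (Negz n) = 0) ->
    \sum_(m < Q) win2 f m%:Z <= W%:R * \sum_(m < Q) f m%:Z ^+ 2.
  move=> fQ fN; rewrite /win2 exchange_big /= mulr_natl.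
  rewrite -[X in _ *+ X]card_ord -sumr_const; apply: ler_sum => i _.
  apply: (@sum_shiftz_le _ (fun x => f x ^+ 2)) => [n|n /fQ->|n].
  - exact: sqr_ge0.
  - by rewrite expr0n.
  - by rewrite fN expr0n.
have := @tot g (fun n h => (vg0 n h).2) (fun n => (vgN n).2).
have := @tot v (fun n h => (vg0 n h).1) (fun n => (vgN n).1).
have : \sum_(m < Q) v m%:Z ^+ 2 <= 2 * A ^+ 2 * W%:R * \sum_(m < Q) win2 g m%:Z
    + 2 * kap ^+ 2 * W%:R * \sum_(m < Q) win2 v m%:Z.
  rewrite !mulr_sumr -big_split /=; apply: ler_sum => m _; exact: pt.
set Sv := \sum_(m < Q) v _ ^+ 2; set Sg := \sum_(m < Q) g _ ^+ 2.
set Wv := \sum_(m < Q) win2 v _; set Wg := \sum_(m < Q) win2 g _.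
move=> H Hv Hg.
have Sv0 : 0 <= Sv by apply: sumr_ge0 => m _; exact: sqr_ge0.
have h1 : 2 * A ^+ 2 * W%:R * Wg <= 2 * A ^+ 2 * W%:R * (W%:R * Sg).
  by apply: ler_wpM2l => //; rewrite !mulr_ge0// sqr_ge0.
have h2 : 2 * kap ^+ 2 * W%:R * Wv <= 2 * kap ^+ 2 * W%:R * (W%:R * Sv).
  by apply: ler_wpM2l => //; rewrite !mulr_ge0// sqr_ge0.
have h3 : 2 * kap ^+ 2 * W%:R * (W%:R * Sv) = 2 * (kap * W%:R) ^+ 2 * Sv by ring.
have h4 : (kap * W%:R) ^+ 2 * Sv <= 1 / 4 * Sv.
  apply: ler_wpM2r => //; have -> : 1 / 4 = (1 / 2) ^+ 2 :> R by field.
  by apply: lerXn2r => //; rewrite nnegrE ?mulr_ge0//.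
have h5 : 2 * A ^+ 2 * W%:R * (W%:R * Sg) = 2 * (A * W%:R) ^+ 2 * Sg by ring.
lra.
Qed.

Lemma dual_coercive (R : realType) (h lam z : R) (k : nat) (E0 E : R) :
  small_coupling h lam z k -> eff_diag h lam k E0 0 = 0 ->
  `|E0 - res_energy h k| <= z ^+ 13 -> `|E - E0| < half_gap h lam k / 2 ->
  exists2 d : R, 0 < d & forall th : R,
    fin_coercive lam (fun m => dual_pot E (2 * h * m%:R + th)) d.
Proof.
move=> Sc c0 near EE; have [A A0 loc] := dual_local Sc c0 near EE.
have z0 := sc_z0 Sc; have z4 := sc_z4 Sc; have zk := sc_zk Sc.
pose M := (2 * k).+1; pose C := 4 * (A * (2 * M).+1%:R) ^+ 2 + 1.
have C0 : 0 < C by rewrite /C ltr_pwDr// mulr_ge0// sqr_ge0.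
exists C^-1 => [|th u N u0 u1 uN]; first by rewrite invr_gt0.
pose v (m : int) := if m is Posz n then u n else 0.
have gE (n : nat) : dual_op h lam E th v n.+1%:Z =
    jac lam (fun m => dual_pot E (2 * h * m%:R + th)) u n.
  rewrite /dual_op /jac.
  have -> : n.+1%:Z + 1 = n.+2%:Z by lia.
  have -> : n.+1%:Z - 1 = n%:Z by lia.
  by rewrite /= [u n.+2 + _]addrC.
have g0 : dual_op h lam E th v 0 = 0.
  rewrite /dual_op (_ : v (0 + 1) = 0)// (_ : v (0 - 1) = 0)// (_ : v 0 = 0)//.
  by rewrite addr0 !mulr0 addr0.
have gN n : dual_op h lam E th v (Negz n) = 0.
  rewrite /dual_op (_ : Negz n + 1 = - n%:Z); last lia.
  rewrite (_ : Negz n - 1 = Negz n.+1); last lia.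
  have -> : v (- n%:Z) = 0 by case: n.
  by rewrite /= addr0 !mulr0 addr0.
have gQ (n : nat) : (N.+1 <= n)%N -> dual_op h lam E th v n%:Z = 0.
  case: n => // n; rewrite ltnS => Nn; rewrite gE /jac !uN ?addr0 ?mulr0 ?addr0//.
  - exact: leqW.
  - exact/leqW/leqW.
have := @local_to_l2 R M A (z ^+ 2) v (dual_op h lam E th v) N.+1 A0 _ _ _ _ (loc th v).
have -> : \sum_(m < N.+1) v m%:Z ^+ 2 = \sum_(n < N) u n.+1 ^+ 2.
  by rewrite big_ord_recl /= u0 expr0n add0r.
have -> : \sum_(m < N.+1) dual_op h lam E th v m%:Z ^+ 2 =
    \sum_(n < N) jac lam (fun m => dual_pot E (2 * h * m%:R + th)) u n ^+ 2.
  rewrite big_ord_recl /= g0 expr0n add0r; apply: eq_bigr => i _.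
  by rewrite -gE.
set S := \sum_(n < N) _; set T := \sum_(n < N) _ => H.
have T0 : 0 <= T by apply: sumr_ge0 => i _; exact: sqr_ge0.
rewrite mulrC ler_pdivrMr//; apply: le_trans (H _ _ _ _) _.
- exact: sqr_ge0.
- have k1 : 1 <= k%:R :> R by rewrite ler1n (sc_k Sc).
  have WE : (2 * M).+1 = (4 * k + 3)%N by rewrite /M; clear; lia.
  have -> : (2 * M).+1%:R = 4 * k%:R + 3 :> R by rewrite WE natrD natrM.
  have : z * (z * k%:R) <= z * (1 / 4) by rewrite ler_pM2l.
  have : z * z <= 1 / 4 * z by rewrite ler_pM2r.
  rewrite expr2; lra.
- by move=> n Nn; split; [rewrite /= uN// ltnW|exact: gQ].
- by move=> n; split.
by rewrite mulrC ler_wpM2l// /C lerDl.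
Qed.

(** * Cut-offs and discrete Fourier analysis *)

(** Sharp truncation of an arbitrary sequence to the indices [2, ..., L+1] changes
    its image only at the two ends, by terms of size [b]. *)
Lemma fin_coercive_cut (R : realFieldType) (b d : R) (V c : nat -> R) (L : nat) :
  fin_coercive b V d -> (0 < L)%N ->
  d * \sum_(i < L) c i.+2 ^+ 2 <= 3 * \sum_(i < L) jac b V c i.+1 ^+ 2
    + 3 * b ^+ 2 * (c 1%N ^+ 2 + c 2%N ^+ 2 + c L.+1 ^+ 2 + c L.+2 ^+ 2).
Proof.
move=> fc; case: L => // L _.
pose v n := if (1 < n < L.+3)%N then c n else 0.
have vin n : (1 < n < L.+3)%N -> v n = c n by move=> H; rewrite /v H.
have vout n : ~~ (1 < n < L.+3)%N -> v n = 0 by move=> /negbTE H; rewrite /v H.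
have vN n : (L.+3 <= n)%N -> v n = 0.
  by move=> Ln; apply: vout; rewrite [(n < _)%N]ltnNge Ln andbF.
have H := fc v L.+3 (vout 0%N isT) (vout 1%N isT) vN.
have S1 : \sum_(n < L.+3) v n.+1 ^+ 2 = \sum_(i < L.+1) c i.+2 ^+ 2.
  rewrite big_ord_recl big_ord_recr /= vout// vN// expr0n add0r addr0.
  by apply: eq_bigr => i _; rewrite /bump /= add1n vin//; move: (ltn_ord i); lia.
have e0 : jac b V v 0 = b * c 2%N.
  by rewrite /jac (vout 0%N)// (vout 1%N)// vin ?mulr0 ?addr0 ?add0r//; lia.
have eL : jac b V v L.+2 = b * c L.+2.
  by rewrite /jac (vN L.+3)// (vN L.+4)// vin ?mulr0 ?addr0//; lia.
have mid i : (i < L.+1)%N -> jac b V v i.+1 ^+ 2 <=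
    3 * jac b V c i.+1 ^+ 2 + (if i == 0%N then 3 * b ^+ 2 * c 1%N ^+ 2 else 0)
      + (if i == L then 3 * b ^+ 2 * c L.+3 ^+ 2 else 0).
  move=> iL.
  pose x := if i == 0%N then b * c 1%N else 0.
  pose y := if i == L then b * c L.+3 else 0.
  have -> : jac b V v i.+1 = jac b V c i.+1 - x - y.
    rewrite /jac (vin i.+2); last lia.
    rewrite /x /y.
    have -> : v i.+1 = c i.+1 - (if i == 0%N then c 1%N else 0).
      case: eqP => [->|/eqP i0]; first by rewrite vout// subrr.
      by rewrite subr0 vin//; lia.
    have -> : v i.+3 = c i.+3 - (if i == L then c L.+3 else 0).
      case: eqP => [->|/eqP i0]; first by rewrite vN// subrr.
      by rewrite subr0 vin//; lia.
    by case: eqP => _; case: eqP => _; ring.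
  have -> : (if i == 0%N then 3 * b ^+ 2 * c 1%N ^+ 2 else 0) = 3 * x ^+ 2.
    by rewrite /x; case: eqP => _; ring.
  have -> : (if i == L then 3 * b ^+ 2 * c L.+3 ^+ 2 else 0) = 3 * y ^+ 2.
    by rewrite /y; case: eqP => _; ring.
  set w := jac _ _ _ _.
  have h1 : 0 <= (w + x) ^+ 2 by exact: sqr_ge0.
  have h2 : 0 <= (w + y) ^+ 2 by exact: sqr_ge0.
  have h3 : 0 <= (x - y) ^+ 2 by exact: sqr_ge0.
  move: h1 h2 h3; rewrite !expr2; lra.
have S2 : \sum_(n < L.+3) jac b V v n ^+ 2 <= 3 * \sum_(i < L.+1) jac b V c i.+1 ^+ 2
    + 3 * b ^+ 2 * c 1%N ^+ 2 + 3 * b ^+ 2 * c L.+3 ^+ 2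
    + b ^+ 2 * c 2%N ^+ 2 + b ^+ 2 * c L.+2 ^+ 2.
  rewrite big_ord_recl big_ord_recr /= e0 eL !exprMn.
  have : \sum_(i < L.+1) jac b V v (bump 0 i) ^+ 2 <=
     \sum_(i < L.+1) (3 * jac b V c i.+1 ^+ 2
       + (if i == 0%N :> nat then 3 * b ^+ 2 * c 1%N ^+ 2 else 0)
      + (if i == L :> nat then 3 * b ^+ 2 * c L.+3 ^+ 2 else 0)).
    by apply: ler_sum => i _; rewrite /bump /= add1n; exact: mid.
  rewrite !big_split /= -mulr_sumr.
  have -> : \sum_(i < L.+1) (if i == 0%N :> nat then 3 * b ^+ 2 * c 1%N ^+ 2 else 0)
     = 3 * b ^+ 2 * c 1%N ^+ 2.
    by rewrite big_ord_recl /= big1 ?addr0// => i.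
  have -> : \sum_(i < L.+1) (if i == L :> nat then 3 * b ^+ 2 * c L.+3 ^+ 2 else 0)
     = 3 * b ^+ 2 * c L.+3 ^+ 2.
    rewrite big_ord_recr /= eqxx big1 ?add0r// => i _.
    by rewrite ltn_eqF.
  lra.
have c2 : 0 <= b ^+ 2 * c 2%N ^+ 2 by rewrite mulr_ge0 ?sqr_ge0.
have cL : 0 <= b ^+ 2 * c L.+2 ^+ 2 by rewrite mulr_ge0 ?sqr_ge0.
rewrite S1 in H; apply: le_trans H _; apply: le_trans S2 _; lra.
Qed.

Lemma sinDpi2n (R : realType) (x : R) (n : nat) : sin (x + pi * (2 * n%:R)) = sin x.
Proof.
have -> : pi * (2 * n%:R) = (pi *+ 2) *+ n :> R by rewrite -mulrnA -[RHS]mulr_natr natrM.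
exact: (periodicn (@sinD2pi R)).
Qed.

(** After multiplication by the sine of the half step the sum telescopes over
    full periods. *)
Lemma cos_sum0 (R : realType) (q s : nat) (phi : R) : (0 < s < q)%N ->
  \sum_(j < q) cos (pi * (2 * s%:R * (j%:R / q%:R) + phi)) = 0.
Proof.
move=> /andP[s0 sq]; have q0 : 0 < q%:R :> R by rewrite ltr0n (leq_trans _ sq).
have s0' : 0 < s%:R :> R by rewrite ltr0n.
have sq' : s%:R < q%:R :> R by rewrite ltr_nat.
set t := s%:R / q%:R :> R.
have t0 : 0 < t by rewrite divr_gt0.
have t1 : t < 1 by rewrite /t ltr_pdivrMr// mul1r.
have st : 0 < sin (pi * t).
  by apply: sin_gt0_pi; rewrite mulr_gt0 ?pi_gt0//= gtr_pMr ?pi_gt0.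
pose g (j : nat) := sin (pi * (2 * t * j%:R - t + phi)).
have step j : 2 * sin (pi * t) * cos (pi * (2 * s%:R * (j%:R / q%:R) + phi)) = g j.+1 - g j.
  have -> : 2 * s%:R * (j%:R / q%:R) + phi = 2 * t * j%:R + phi by rewrite /t; ring.
  rewrite /g -[j.+1%:R]natr1.
  have -> : pi * (2 * t * (j%:R + 1) - t + phi) = pi * (2 * t * j%:R + phi) + pi * t by ring.
  have -> : pi * (2 * t * j%:R - t + phi) = pi * (2 * t * j%:R + phi) - pi * t by ring.
  rewrite sinD sinB; ring.
have K : 2 * sin (pi * t) != 0 by rewrite mulf_neq0// gt_eqF.
apply: (mulfI K); rewrite mulr0 mulr_sumr.
rewrite (eq_bigr (fun j : 'I_q => g j.+1 - g j)) => [|j _]; last exact: step.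
rewrite -(big_mkord xpredT (fun j => g j.+1 - g j)) telescope_sumr//.
apply/eqP; rewrite subr_eq0; apply/eqP.
rewrite /g mulr0 -[RHS](sinDpi2n _ s); congr sin.
by rewrite /t; field; rewrite gt_eqF.
Qed.

(** Orthogonality of the exponentials on a regular grid with more than twice as
    many nodes as frequencies. *)
Lemma grid_parseval (R : realType) (q N : nat) (a phi : nat -> R) : (2 * N < q)%N ->
  \sum_(j < q) (\sum_(n < N) a n * cos (pi * (2 * n.+1%:R * (j%:R / q%:R) + phi n))) ^+ 2
    = q%:R / 2 * \sum_(n < N) a n ^+ 2.
Proof.
move=> Nq.
pose C (n j : nat) : R := cos (pi * (2 * n.+1%:R * (j%:R / q%:R) + phi n)).
have orth n m : (n < m < N)%N -> \sum_(j < q) C n j * C m j = 0.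
  move=> /andP[nm mN].
  have E (j : nat) : C n j * C m j = 2^-1 *
     (cos (pi * (2 * (m - n)%:R * (j%:R / q%:R) + (phi m - phi n)))
    + cos (pi * (2 * (m.+1 + n.+1)%:R * (j%:R / q%:R) + (phi m + phi n)))).
    have -> : (m - n)%:R = m.+1%:R - n.+1%:R :> R by rewrite -natrB ?subSS// ltnS ltnW.
    rewrite natrD /C; set M := m.+1%:R; set P := n.+1%:R; set t := j%:R / q%:R.
    have -> : pi * (2 * (M - P) * t + (phi m - phi n)) =
      pi * (2 * M * t + phi m) - pi * (2 * P * t + phi n) by ring.
    have -> : pi * (2 * (M + P) * t + (phi m + phi n)) =
      pi * (2 * M * t + phi m) + pi * (2 * P * t + phi n) by ring.
    by rewrite cosB cosD; field.
  rewrite (eq_bigr _ (fun (j : 'I_q) _ => E j)) -mulr_sumr big_split /=.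
  rewrite !cos_sum0 ?addr0 ?mulr0//; lia.
have diag n : (n < N)%N -> \sum_(j < q) C n j * C n j = q%:R / 2.
  move=> nN.
  have E (j : nat) : C n j * C n j = 2^-1 *
     (1 + cos (pi * (2 * (n.+1 + n.+1)%:R * (j%:R / q%:R) + (phi n + phi n)))).
    rewrite natrD /C; set P := n.+1%:R; set t := j%:R / q%:R.
    set x := pi * (2 * P * t + phi n).
    have -> : pi * (2 * (P + P) * t + (phi n + phi n)) = x + x by rewrite /x; ring.
    have := cos2Dsin2 x; rewrite cosD !expr2 => h; lra.
  rewrite (eq_bigr _ (fun (j : 'I_q) _ => E j)) -mulr_sumr big_split /=.
  rewrite cos_sum0 ?addr0; last lia.
  by rewrite sumr_const card_ord mulrC.
under eq_bigr => j _.
  rewrite expr2 big_distrlr /=.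
  over.
rewrite exchange_big /= mulr_sumr; apply: eq_bigr => n _.
rewrite exchange_big /= (bigD1 n) //= [X in _ + X]big1 ?addr0 => [|m mn].
  rewrite -(diag n)// mulr_suml; apply: eq_bigr => j _; rewrite /C; ring.
have nm : n != m :> nat by rewrite eq_sym -(inj_eq val_inj) in mn.
rewrite (eq_bigr (fun j : 'I_q => a n * a m * (C n j * C m j))) => [|j _].
  rewrite -mulr_sumr; case: (ltnP n m) => h; first by rewrite orth ?mulr0// h ltn_ord.
  rewrite (eq_bigr (fun j : 'I_q => C m j * C n j)) => [|j _]; last exact: mulrC.
  by rewrite orth ?mulr0// ltn_neqAle eq_sym nm h ltn_ord.
by rewrite /C; ring.
Qed.

Lemma le_of_linear_growth (R : archiRealFieldType) (a b c : R) :
  (forall L, (0 < L)%N -> L%:R * a <= L%:R * b + c) -> a <= b.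
Proof.
move=> H; rewrite leNgt; apply/negP => ba.
have ab0 : 0 < a - b by rewrite subr_gt0.
have [L hL] : exists L : nat, `|c| / (a - b) < L%:R.
  by exists (Num.bound (`|c| / (a - b))); apply: archi_boundP; rewrite divr_ge0// ltW.
rewrite ltr_pdivrMr// in hL.
have L0 : (0 < L)%N.
  rewrite lt0n; apply/eqP => L0; move: hL; rewrite L0 mul0r.
  by have := normr_ge0 c; lra.
have := H L L0; have := ler_norm c; lra.
Qed.

(** * Aubry duality *)

Lemma sum_ord_shift (V : zmodType) (F : nat -> V) (N : nat) :
  F 0%N = 0 -> F N = 0 -> \sum_(i < N) F i.+1 = \sum_(i < N) F i.
Proof.
move=> F0 FN; case: N FN => [|N] FN; first by rewrite !big_ord0.
by rewrite [RHS]big_ord_recl F0 add0r big_ord_recr /= FN addr0.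
Qed.

(** Aubry duality: the Fourier series, evaluated along the orbit
    [th + 2 h m], of the image of [u] by the almost Mathieu operator is the image
    by the dual one. *)
Lemma aubry_duality (R : realType) (h lam E x th : R) (u : nat -> R) (N m : nat) :
  u 0%N = 0 -> u 1%N = 0 -> (forall n, (N <= n)%N -> u n = 0) ->
  let xi (n : nat) (m : nat) := pi * (2 * n%:R * (th / 2) + m%:R * (2 * h * n%:R + 2 * x)) in
  let V := fun n : nat => 2 * lam * cos (pi * (2 * (x + n%:R * h))) - E in
  jac lam (fun m => dual_pot E (2 * h * m%:R + th))
    (fun m => \sum_(n < N) u n.+1 * cos (xi n.+1 m)) m
  = \sum_(n < N) jac 1 V u n * cos (xi n.+1 m.+1).
Proof.
move=> u0 u1 uN xi V; rewrite /jac.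
pose y (t : R) := pi * (2 * t * (th / 2) + m.+1%:R * (2 * h * t + 2 * x)).
have yE n : xi n m.+1 = y n%:R by [].
have h1 n : lam * (u n * cos (xi n m) + u n * cos (xi n m.+2))
    = 2 * lam * cos (pi * (2 * (x + n%:R * h))) * u n * cos (y n%:R).
  have -> : xi n m = y n%:R - pi * (2 * (x + n%:R * h)).
    by rewrite /xi /y -[m.+1%:R]natr1; ring.
  have -> : xi n m.+2 = y n%:R + pi * (2 * (x + n%:R * h)).
    by rewrite /xi /y -[m.+2%:R]natr1; ring.
  by rewrite cosB cosD; ring.
have h2 n : 2 * cos (pi * (2 * h * m.+1%:R + th)) * cos (y n%:R)
   = cos (y (n%:R + 1)) + cos (y (n%:R - 1)).
  have -> : y (n%:R + 1) = y n%:R + pi * (2 * h * m.+1%:R + th) by rewrite /y; field.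
  have -> : y (n%:R - 1) = y n%:R - pi * (2 * h * m.+1%:R + th) by rewrite /y; field.
  by rewrite cosB cosD; ring.
rewrite -big_split /= !mulr_sumr -big_split /=.
rewrite (eq_bigr (fun n : 'I_N => V n.+1 * u n.+1 * cos (y n.+1%:R)
   + (u n.+1 * cos (y (n.+1%:R + 1)) + u n.+1 * cos (y (n.+1%:R - 1))))); last first.
  move=> n _; rewrite h1 -mulrDr -h2 yE /V /dual_pot; ring.
rewrite [RHS](eq_bigr (fun n : 'I_N => V n.+1 * u n.+1 * cos (y n.+1%:R)
   + (u n * cos (y n.+1%:R) + u n.+2 * cos (y n.+1%:R)))); last first.
  move=> n _; rewrite mul1r yE; ring.
rewrite !big_split /=; congr (_ + (_ + _)).
  rewrite (@sum_ord_shift _ (fun n : nat => u n * cos (y (n%:R + 1)))); last first.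
  - by rewrite uN// mul0r.
  - by rewrite u0 mul0r.
  by apply: eq_bigr => n _; rewrite natr1.
rewrite -(@sum_ord_shift _ (fun n : nat => u n.+1 * cos (y (n.+1%:R - 1)))); last first.
- by rewrite uN ?mul0r.
- by rewrite u1 mul0r.
by apply: eq_bigr => n _; rewrite -[n.+2%:R]natr1 addrK.
Qed.

(** Average the dual inequality over the phases [th] of a grid, for a Fourier
    series [c] truncated to [L] sites.  By Parseval every site contributes the same
    amount, so both sides grow linearly in [L] while the truncation errors stay
    bounded: divide by [L] and let it tend to infinity. *)
Lemma space_coercive (R : realType) (h lam E d : R) :
  (forall th : R, fin_coercive lam (fun m => dual_pot E (2 * h * m%:R + th)) d) ->
  forall x : R,
  fin_coercive 1 (fun n : nat => 2 * lam * cos (pi * (2 * (x + n%:R * h))) - E) (d / 3).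
Proof.
move=> fc x u N u0 u1 uN; pose V (n : nat) := 2 * lam * cos (pi * (2 * (x + n%:R * h))) - E.
rewrite -/V.
(* products of two modes below frequency [N] have frequencies below [2 N] *)
pose q := (2 * N).+1.
pose th (j : nat) : R := 2 * (j%:R / q%:R).
pose xi (j n m : nat) : R :=
  pi * (2 * n%:R * (th j / 2) + m%:R * (2 * h * n%:R + 2 * x)).
pose c j m := \sum_(n < N) u n.+1 * cos (xi j n.+1 m).
have q0 : 0 < q%:R / 2 :> R by rewrite divr_gt0.
have thE j : th j / 2 = j%:R / q%:R by rewrite /th mulrAC divff ?mul1r.
have pars (a : nat -> R) m :
    \sum_(j < q) (\sum_(n < N) a n * cos (xi j n.+1 m)) ^+ 2 =
    q%:R / 2 * \sum_(n < N) a n ^+ 2.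
  rewrite -(grid_parseval a (fun n => pi * 0 + m%:R * (2 * h * n.+1%:R + 2 * x)) (ltnSn _)).
  apply: eq_bigr => j _; congr (_ ^+ 2); apply: eq_bigr => n _.
  by rewrite /xi thE mulr0 add0r.
set U := \sum_(n < N) u n.+1 ^+ 2; set W := \sum_(n < N) _ ^+ 2.
have key : d * U <= 3 * W.
  apply: (@le_of_linear_growth _ _ _ (12 * lam ^+ 2 * U)) => L L0.
  rewrite -(ler_pM2l q0).
  have H : \sum_(j < q) (d * \sum_(i < L) c j i.+2 ^+ 2) <=
     \sum_(j < q) (3 * \sum_(i < L)
       jac lam (fun m => dual_pot E (2 * h * m%:R + th j)) (c j) i.+1 ^+ 2
    + 3 * lam ^+ 2 * (c j 1%N ^+ 2 + c j 2%N ^+ 2 + c j L.+1 ^+ 2 + c j L.+2 ^+ 2)).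
    by apply: ler_sum => j _; exact: fin_coercive_cut.
  have cU m : \sum_(j < q) c j m ^+ 2 = q%:R / 2 * U by exact: (pars (fun n => u n.+1)).
  have cW m : \sum_(j < q) jac lam (fun m => dual_pot E (2 * h * m%:R + th j)) (c j) m ^+ 2
      = q%:R / 2 * W.
    rewrite -(pars (jac 1 V u) m.+1); apply: eq_bigr => j _; congr (_ ^+ 2).
    exact: aubry_duality.
  rewrite big_split /= -!mulr_sumr !big_split /= !cU in H.
  rewrite exchange_big [X in _ <= 3 * X + _]exchange_big /= in H.
  rewrite (eq_bigr (fun=> q%:R / 2 * U)) in H; last by move=> i _; exact: cU.
  rewrite [X in _ <= 3 * X + _](eq_bigr (fun=> q%:R / 2 * W)) in H; last first.
    by move=> i _; exact: cW.
  have sL (a : R) : \sum_(i < L) a = L%:R * a by rewrite sumr_const card_ord mulr_natl.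
  rewrite !sL in H.
  move: H; lra.
rewrite mulrAC ler_pdivrMr// [leRHS]mulrC; exact: key.
Qed.

(** * Square integrable functions and translations *)

Local Open Scope classical_set_scope.

Definition sq_integrable (R : realType) (u : R -> R) : Prop :=
  measurable_fun [set: R] u /\
  (@lebesgue_measure R).-integrable [set: R] (fun x => (u x ^+ 2)%:E).

Lemma sq_integrable_Lfun (R : realType) (u : R -> R) :
  u \in Lfun (@lebesgue_measure R) 2%:E <-> sq_integrable u.
Proof.
split=> [H|[mu iu]].
  split; last exact: Lfun2_integrable_sqr.
  by move: (sub_Lfun_mfun H); rewrite inE.
rewrite inE; apply/andP; split; rewrite inE//=.
rewrite /finite_norm unlock /Lnorm poweR_lty//=.
move/integrableP: iu => [_]; apply: le_lt_trans.
rewrite le_eqVlt; apply/orP; left; apply/eqP; apply: eq_integral => x _.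
by rewrite /= powR_mulrn// real_normK ?num_real// ger0_norm// sqr_ge0.
Qed.

Lemma measurable_shift (R : realType) (a : R) :
  measurable_fun [set: R] (fun x : R => x + a).
Proof. exact: measurable_funD. Qed.

(** Uniqueness of the Lebesgue measure makes it invariant by translations. *)
Lemma lebesgue_measure_shift (R : realType) (a : R) (A : set R) : measurable A ->
  @lebesgue_measure R ((fun x => x + a) @^-1` A) = @lebesgue_measure R A.
Proof.
pose phi (x : measurableTypeR R) : measurableTypeR R := x + a.
have mphi : measurable_fun setT phi := measurable_shift a.
move=> mA; apply/esym; change (lebesgue_measure A = pushforward (@lebesgue_measure R) phi A).
apply: lebesgue_measure_unique => //= X [[u v] _ <-] /=.
rewrite /pushforward.
have -> : phi @^-1` `]u, v] = `](u - a), (v - a)]%classic.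
  apply/seteqP; split=> x /=; rewrite !in_itv/= /phi => /andP[h1 h2]; apply/andP; split; lra.
rewrite !lebesgue_measure_itv /= !lte_fin ltrD2r; case: ifP => // _.
by rewrite -!EFinB; congr (_%:E); ring.
Qed.

Lemma ge0_integral_shift (R : realType) (f : R -> \bar R) (a : R) :
  measurable_fun [set: R] f -> (forall x, 0 <= f x)%E ->
  (\int[@lebesgue_measure R]_x f ((x : R) + a)%R = \int[@lebesgue_measure R]_x f x)%E.
Proof.
move=> mf f0; pose phi (x : measurableTypeR R) : measurableTypeR R := x + a.
have mphi : measurable_fun setT phi := measurable_shift a.
have := @ge0_integral_pushforward _ _ _ _ R phi mphi (@lebesgue_measure R)
  setT f measurableT mf (fun y _ => f0 y).
rewrite preimage_setT => <-.
by apply: eq_measure_integral => A mA _; apply: lebesgue_measure_shift.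
Qed.

Lemma ae_shift (R : realType) (P : R -> Prop) (a : R) :
  {ae @lebesgue_measure R, forall x, P x} ->
  {ae @lebesgue_measure R, forall x, P (x + a)}.
Proof.
move=> [N [mN N0 PN]]; exists ((fun x => x + a) @^-1` N); split.
- by rewrite -[_ @^-1` _]setTI; apply: measurable_shift.
- by rewrite -[RHS]N0; exact: lebesgue_measure_shift.
- by move=> x /= Px; apply: PN.
Qed.

Lemma integral_shift (R : realType) (f : R -> \bar R) (a : R) :
  measurable_fun [set: R] f ->
  (\int[@lebesgue_measure R]_x f ((x : R) + a)%R = \int[@lebesgue_measure R]_x f x)%E.
Proof.
move=> mf; rewrite integralE [RHS]integralE; congr (_ - _)%E.
- rewrite -(ge0_integral_shift a (measurable_funepos mf) (funepos_ge0 f)).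
  by apply: eq_integral => x _; rewrite !funeposE.
- rewrite -(ge0_integral_shift a (measurable_funeneg mf) (funeneg_ge0 f)).
  by apply: eq_integral => x _; rewrite !funenegE.
Qed.

Lemma integrable_shift (R : realType) (f : R -> \bar R) (a : R) :
  (@lebesgue_measure R).-integrable [set: R] f ->
  (@lebesgue_measure R).-integrable [set: R] (fun x => f (x + a)).
Proof.
move=> /integrableP[mf fi]; apply/integrableP; split.
  by apply: (measurableT_comp mf); exact: measurable_shift.
rewrite (ge0_integral_shift a (f := fun x => `|f x|%E))//.
exact: measurableT_comp.
Qed.

Section SqIntegrable.
Context (R : realType).
Implicit Types u v w : R -> R.
Local Notation mu := (@lebesgue_measure R).

Lemma sq_integrable_mul u w : sq_integrable u -> sq_integrable w ->
  mu.-integrable [set: R] (EFin \o (fun x => u x * w x)).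
Proof.
move=> /sq_integrable_Lfun hu /sq_integrable_Lfun hw.
exact/Lfun1_integrable/Lfun2_mul_Lfun1.
Qed.

Lemma sq_integrable_le u w (C : R) : measurable_fun [set: R] u -> sq_integrable w ->
  (forall x, u x ^+ 2 <= C * w x ^+ 2) -> sq_integrable u.
Proof.
move=> mu' [mw iw] uw; split=> //.
apply: (le_integrable _ _ _ (integrableZl _ C iw)) => //.
  by apply/measurable_EFinP; exact: measurable_funX.
move=> x _; rewrite -EFinM !abse_EFin lee_fin ger0_norm ?sqr_ge0//.
by apply: le_trans (uw x) (ler_norm _).
Qed.

Lemma sq_integrableD u w : sq_integrable u -> sq_integrable w ->
  sq_integrable (fun x => u x + w x).
Proof.
move=> [mu' iu] [mw iw]; split; first exact: measurable_funD.
have := integrableD measurableT (integrableZl measurableT 2 iu) (integrableZl measurableT 2 iw).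
apply: le_integrable => //.
  by apply/measurable_EFinP/measurable_funX; exact: measurable_funD.
move=> x _; rewrite -!EFinM -EFinD !abse_EFin lee_fin ger0_norm ?sqr_ge0//.
apply: le_trans (ler_norm _); have : 0 <= (u x - w x) ^+ 2 by exact: sqr_ge0.
by rewrite sqrrB sqrrD; lra.
Qed.

Lemma sq_integrableZ (k : R) u : sq_integrable u -> sq_integrable (fun x => k * u x).
Proof.
move=> hu; apply: (@sq_integrable_le _ u (k ^+ 2)) => //.
  by apply: measurable_funM => //; case: hu.
by move=> x; rewrite exprMn.
Qed.

Lemma sq_integrableB u w : sq_integrable u -> sq_integrable w ->
  sq_integrable (fun x => u x - w x).
Proof.
move=> hu /(sq_integrableZ (-1)) hw.
have := sq_integrableD hu hw; congr sq_integrable.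
by apply/funext => x; rewrite mulN1r.
Qed.

Lemma sq_integrable_shift (a : R) u : sq_integrable u ->
  sq_integrable (fun x => u (x + a)).
Proof.
move=> [mu' iu]; split; last exact: (integrable_shift a iu).
by apply: (measurableT_comp mu'); exact: measurable_shift.
Qed.

Definition ip u w : R := \int[mu]_x (u x * w x).

Lemma ipC u w : ip u w = ip w u.
Proof. by apply: eq_Rintegral => x _; rewrite mulrC. Qed.

Lemma ipDl u v w : sq_integrable u -> sq_integrable v -> sq_integrable w ->
  ip (fun x => u x + v x) w = ip u w + ip v w.
Proof.
move=> hu hv hw; rewrite /ip -RintegralD//; try exact: sq_integrable_mul.
by apply: eq_Rintegral => x _; rewrite mulrDl.
Qed.

Lemma ipZl (k : R) u w : sq_integrable u -> sq_integrable w ->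
  ip (fun x => k * u x) w = k * ip u w.
Proof.
move=> hu hw; rewrite /ip -RintegralZl//; last exact: sq_integrable_mul.
by apply: eq_Rintegral => x _; rewrite mulrA.
Qed.

Lemma ipBl u v w : sq_integrable u -> sq_integrable v -> sq_integrable w ->
  ip (fun x => u x - v x) w = ip u w - ip v w.
Proof.
move=> hu hv hw; rewrite /ip -RintegralB//; try exact: sq_integrable_mul.
by apply: eq_Rintegral => x _; rewrite mulrBl.
Qed.

Lemma ip_ge0 u : 0 <= ip u u.
Proof. by apply: Rintegral_ge0 => x _; rewrite -expr2 sqr_ge0. Qed.

Lemma ip_sqr u : ip u u = \int[mu]_x (u x ^+ 2).
Proof. by apply: eq_Rintegral => x _; rewrite expr2. Qed.

Lemma ip_shift (a : R) u w : sq_integrable u -> sq_integrable w ->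
  ip (fun x => u (x + a)) w = ip u (fun x => w (x - a)).
Proof.
move=> hu hw.
have [m _] := hu; have [m' _] := sq_integrable_shift (- a) hw.
rewrite /ip /Rintegral.
have := @integral_shift R (fun x => (u x * w (x - a))%:E) a _.
move=> <-; last by apply/measurable_EFinP; exact: measurable_funM.
by congr fine; apply: eq_integral => x _; rewrite addrK.
Qed.

Lemma ip_shift_sqr (a : R) u : sq_integrable u ->
  ip (fun x => u (x + a)) (fun x => u (x + a)) = ip u u.
Proof.
move=> hu; rewrite ip_shift//; last exact: sq_integrable_shift.
by congr (ip u _); apply/funext => x; rewrite subrK.
Qed.

Lemma ip_le (u w : R -> R) : mu.-integrable [set: R] (EFin \o u) ->
  mu.-integrable [set: R] (EFin \o w) -> (forall x, u x <= w x) ->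
  \int[mu]_x u x <= \int[mu]_x w x.
Proof. by move=> iu iw uw; apply: le_Rintegral => // x _; exact: uw. Qed.

End SqIntegrable.

(** * Hopping operators on the line *)

Definition hop (R : realType) (h : R) (V u : R -> R) (x : R) : R :=
  u (x + h) + u (x - h) + V x * u x.

Section Hop.
Context (R : realType) (h : R) (V : R -> R) (b : R).
Hypotheses (mV : measurable_fun [set: R] V) (Vb : forall x, `|V x| <= b).
Implicit Types u w : R -> R.
Local Notation mu := (@lebesgue_measure R).
Local Notation T := (hop h V).

Lemma sq_integrable_mulV u : sq_integrable u -> sq_integrable (fun x => V x * u x).
Proof.
move=> hu; apply: (@sq_integrable_le _ _ u (b ^+ 2)) => //.
  by apply: measurable_funM => //; case: hu.
move=> x; rewrite exprMn ler_wpM2r ?sqr_ge0// -real_normK ?num_real//.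
by apply: lerXn2r; rewrite ?nnegrE ?Vb// (le_trans _ (Vb x)).
Qed.

Lemma hop_sq_integrable u : sq_integrable u -> sq_integrable (T u).
Proof.
move=> hu; apply: sq_integrableD; last exact: sq_integrable_mulV.
by apply: sq_integrableD; exact: sq_integrable_shift.
Qed.

Lemma hop_sym u w : sq_integrable u -> sq_integrable w -> ip (T u) w = ip u (T w).
Proof.
move=> hu hw; have hs a v := @sq_integrable_shift R a v.
rewrite /hop ipDl//; [|by apply: sq_integrableD; apply: hs|exact: sq_integrable_mulV].
rewrite ipDl//; [|exact: hs|exact: hs].
rewrite [RHS]ipC ipDl//; [|by apply: sq_integrableD; apply: hs|exact: sq_integrable_mulV].
rewrite ipDl//; [|exact: hs|exact: hs].
rewrite (ip_shift h hu hw) (ip_shift (- h) hu hw) [ip (fun x => w (x + h)) _]ipC.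
rewrite [ip (fun x => w (x - h)) _]ipC; congr (_ + _).
  rewrite addrC; congr (ip u _ + _); apply/funext => x; congr (w (x + _)).
  by rewrite opprK.
by apply: eq_Rintegral => x _; ring.
Qed.

Lemma hop_bound u : sq_integrable u -> ip (T u) (T u) <= 3 * (2 + b ^+ 2) * ip u u.
Proof.
move=> hu; have hs a := @sq_integrable_shift R a u hu.
have hV := sq_integrable_mulV hu; have hT := hop_sq_integrable hu.
have iu := sq_integrable_mul hu hu.
have i1 := sq_integrable_mul (hs h) (hs h).
have i2 := sq_integrable_mul (hs (- h)) (hs (- h)).
pose F x := 3 * (u (x + h) * u (x + h)) + 3 * (u (x - h) * u (x - h))
   + 3 * b ^+ 2 * (u x * u x).
have Z (k : R) f : mu.-integrable [set: R] (EFin \o f) ->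
    mu.-integrable [set: R] (EFin \o (fun x => k * f x)).
  by move=> /(integrableZl measurableT k); congr (_.-integrable).
have D f g : mu.-integrable [set: R] (EFin \o f) -> mu.-integrable [set: R] (EFin \o g) ->
    mu.-integrable [set: R] (EFin \o (fun x => f x + g x)).
  by move=> hf /(integrableD measurableT hf); congr (_.-integrable).
apply: le_trans (_ : \int[mu]_x F x <= _).
  apply: ip_le; [exact: sq_integrable_mul| |].
    by apply: (D (fun x => _ + _)); [apply: D|]; apply: Z.
  move=> x; rewrite /F /hop; set p := u (x + h); set q := u (x - h).
  have Vx : (V x * u x) ^+ 2 <= b ^+ 2 * (u x * u x).
    rewrite exprMn -expr2 ler_wpM2r ?sqr_ge0// -real_normK ?num_real//.
    by apply: lerXn2r; rewrite ?nnegrE ?Vb// (le_trans _ (Vb x)).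
  set r := V x * u x in Vx *.
  have h1 : 0 <= (p - q) ^+ 2 by exact: sqr_ge0.
  have h2 : 0 <= (p - r) ^+ 2 by exact: sqr_ge0.
  have h3 : 0 <= (q - r) ^+ 2 by exact: sqr_ge0.
  move: h1 h2 h3 Vx; rewrite !expr2; lra.
rewrite /F RintegralD//; [|by apply: D; apply: Z|exact: Z].
rewrite RintegralD//; [|exact: Z|exact: Z].
rewrite !RintegralZl//.
have := ip_shift_sqr h hu; have := ip_shift_sqr (- h) hu; rewrite /ip => -> ->.
by rewrite le_eqVlt; apply/orP; left; apply/eqP; ring.
Qed.

Lemma Rintegral_sum_sqr (w : R -> R) (a : nat -> R) (L : nat) : sq_integrable w ->
  let F x := \sum_(i < L) w (x + a i) ^+ 2 in
  mu.-integrable [set: R] (EFin \o F) /\ \int[mu]_x F x = L%:R * ip w w.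
Proof.
move=> hw; elim: L => [|L [IHi IH]] F.
  have F0 : F = cst 0 by apply/funext => x; rewrite /F big_ord0.
  split; first by rewrite F0; exact: integrable0.
  by rewrite F0 Rintegral_cst// mul0r mul0r.
have FE : F = (fun x => \sum_(i < L) w (x + a i) ^+ 2 + w (x + a L) ^+ 2).
  by apply/funext => x; rewrite /F big_ord_recr.
have hs := sq_integrable_shift (a L) hw.
have [_ i2] := hs.
split.
  by rewrite FE; have := integrableD measurableT IHi i2; congr (_.-integrable).
rewrite FE RintegralD// IH -[L.+1%:R]natr1 mulrDl mul1r; congr (_ + _).
rewrite -(ip_shift_sqr (a L) hw).
by apply: eq_Rintegral => x _; rewrite expr2.
Qed.

(** Integrate the finite inequality satisfied by the samples
    [u (x + n h)], which the translations leave on average unchanged. *)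
Lemma hop_coercive (d : R) : (forall x, fin_coercive 1 (fun n => V (x + n%:R * h)) d) ->
  forall u, sq_integrable u -> d / 3 * ip u u <= ip (T u) (T u).
Proof.
move=> fc u hu; have hT := hop_sq_integrable hu.
suff key : d * ip u u <= 3 * ip (T u) (T u).
  by rewrite mulrAC ler_pdivrMr// mulrC; move: key; lra.
apply: (@le_of_linear_growth _ _ _ (12 * ip u u)) => L L0.
pose A (x : R) := \sum_(i < L) u (x + i.+2%:R * h) ^+ 2.
pose B (x : R) := \sum_(i < L) T u (x + i.+2%:R * h) ^+ 2.
pose nn : nat -> nat := nth 0%N [:: 1%N; 2; L.+1; L.+2].
pose C (x : R) := \sum_(i < 4) u (x + (nn i)%:R * h) ^+ 2.
have [Ai AE] := @Rintegral_sum_sqr u (fun i => i.+2%:R * h) L hu.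
have [Bi BE] := @Rintegral_sum_sqr (T u) (fun i => i.+2%:R * h) L hT.
have [Ci CE] := @Rintegral_sum_sqr u (fun i => (nn i)%:R * h) 4 hu.
have pt x : d * A x <= 3 * B x + 3 * C x.
  have := @fin_coercive_cut R 1 d _ (fun n => u (x + n%:R * h)) L (fc x) L0.
  have -> : \sum_(i < L) jac 1 (fun n : nat => V (x + n%:R * h))
      (fun n : nat => u (x + n%:R * h)) i.+1 ^+ 2 = B x.
    apply: eq_bigr => i _; congr (_ ^+ 2); rewrite /jac /hop mul1r addrC [RHS]addrC.
    congr (_ + _); rewrite addrC; congr (u _ + u _).
      by rewrite -[i.+3%:R]natr1; ring.
    by rewrite -[i.+2%:R]natr1; ring.
  by rewrite expr1n mulr1 /C !big_ord_recl big_ord0 /= addr0 !addrA.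
have Z (k : R) f : mu.-integrable [set: R] (EFin \o f) ->
    mu.-integrable [set: R] (EFin \o (fun x => k * f x)).
  by move=> /(integrableZl measurableT k); congr (_.-integrable).
have : \int[mu]_x (d * A x) <= \int[mu]_x (3 * B x + 3 * C x).
  apply: ip_le => //; first exact: Z.
  by have := integrableD measurableT (Z 3 _ Bi) (Z 3 _ Ci); congr (_.-integrable).
rewrite RintegralD//; [|exact: Z|exact: Z].
by rewrite !RintegralZl// AE BE CE; lra.
Qed.

End Hop.

(** * Convergence of series of square integrable functions *)

Lemma geom_dominated_cvg (R : realType) (a : nat -> R) (C kap : R) :
  0 <= C -> 0 < kap < 1 -> (forall n, `|a n| <= C * kap ^+ n) ->
  exists2 l : R, series a @ \oo --> l & `|l| <= C / (1 - kap).
Proof.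
move=> C0 /andP[k0 k1] ha.
have k1' : `|kap| < 1 by rewrite gtr0_norm.
have ca : cvgn (series a).
  have v0 n : 0 <= geometric C kap n by rewrite /geometric /= mulr_ge0// exprn_ge0// ltW.
  apply: normed_cvg; apply: (@series_le_cvg _ _ (geometric C kap)) => //.
  - by move=> n; exact: normr_ge0.
  - exact: is_cvg_geometric_series.
have bd n : `|series a n| <= C / (1 - kap).
  apply: le_trans (geometric_le_lim n C0 k0 k1').
  rewrite /series /=; apply: le_trans (ler_norm_sum _ _ _) _.
  by apply: ler_sum => i _; exact: ha.
exists (limn (series a)) => //.
rewrite ler_norml; apply/andP; split.
  apply: limr_ge => //; near=> n; have := bd n; rewrite ler_norml => /andP[] //.
by apply: limr_le => //; near=> n; have := bd n; rewrite ler_norml => /andP[].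
Unshelve. all: by end_near. Qed.

Lemma sum_geom_le (R : realFieldType) (r : R) (n : nat) : 0 <= r < 1 ->
  \sum_(i < n) r ^+ i <= (1 - r)^-1.
Proof.
move=> /andP[r0 r1]; rewrite -[leRHS]mul1r ler_pdivlMr ?subr_gt0//.
have -> : (\sum_(i < n) r ^+ i) * (1 - r) = 1 - r ^+ n.
  elim: n => [|n IH]; first by rewrite big_ord0 mul0r expr0 subrr.
  by rewrite big_ord_recr /= mulrDl IH exprSr; ring.
by rewrite gerBl exprn_ge0.
Qed.

(** A Riesz-Fischer argument: the weighted square function
    [W = sum kap^(-2n) f_n^2] has finite integral, and at every point where it is
    finite the series is dominated by a geometric one. *)
Lemma sq_series_cvg (R : realType) (q : R) : 0 < q < 1 ->
  exists2 C : R, 0 <= C & forall (f : nat -> R -> R) (A : R), 0 <= A ->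
    (forall n, sq_integrable (f n)) -> (forall n, ip (f n) (f n) <= A * q ^+ n) ->
    exists g : R -> R, [/\ sq_integrable g, ip g g <= C * A &
      {ae @lebesgue_measure R, forall x, series (f ^~ x) @ \oo --> g x}].
Proof.
move=> /andP[q0 q1]; pose kap : R := (1 + q) / 2.
(* [kap^2] lies strictly between [q] and [1] *)
have k0 : 0 < kap by rewrite /kap; lra.
have k1 : kap < 1 by rewrite /kap; lra.
have k20 : 0 < kap ^+ 2 by rewrite exprn_gt0.
have qk : q < kap ^+ 2.
  have -> : kap ^+ 2 = q + ((1 - q) / 2) ^+ 2 by rewrite /kap; field.
  by rewrite ltrDl exprn_gt0//; lra.
pose r := q / kap ^+ 2.
have r0 : 0 <= r by rewrite divr_ge0// ltW.
have r1 : r < 1 by rewrite /r ltr_pdivrMr// mul1r.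
pose C1 := (1 - r)^-1; pose C2 := ((1 - kap)^-1) ^+ 2.
have C10 : 0 <= C1 by rewrite invr_ge0 subr_ge0 ltW.
have C20 : 0 <= C2 by exact: sqr_ge0.
exists (C2 * C1); first exact: mulr_ge0.
move=> f A A0 hf fA.
pose t n x : \bar R := ((kap ^+ 2) ^- n * f n x ^+ 2)%:E.
pose W x : \bar R := (\sum_(n <oo) t n x)%E.
have kn0 n : 0 <= (kap ^+ 2) ^- n by rewrite invr_ge0 exprn_ge0// ltW.
have t0 n x : (0 <= t n x)%E by rewrite lee_fin mulr_ge0// sqr_ge0.
have mt n : measurable_fun [set: R] (t n).
  apply/measurable_EFinP; apply: measurable_funM => //.
  by apply: measurable_funX; case: (hf n).
have mW : measurable_fun [set: R] W.
  exact: (@ge0_emeasurable_sum _ _ R setT t predT (fun k x _ _ => t0 k x) (fun k _ => mt k)).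
have W0 x : (0 <= W x)%E by apply: nneseries_ge0 => n _ _; exact: t0.
have It n : (\int[@lebesgue_measure R]_x t n x = ((kap ^+ 2) ^- n * ip (f n) (f n))%:E)%E.
  have [_ i2] := hf n.
  rewrite /t; under eq_integral => x _ do rewrite EFinM.
  rewrite integralZl// EFinM; congr (_ * _)%E.
  rewrite ip_sqr /Rintegral fineK//; exact: integrable_fin_num.
have IW : (\int[@lebesgue_measure R]_x W x <= (A * C1)%:E)%E.
  rewrite /W.
  rewrite (@integral_nneseries _ _ R lebesgue_measure setT measurableT t mt
    (fun n x _ => t0 n x)).
  apply: lime_le.
    by apply: is_cvg_nneseries => n _ _; apply: integral_ge0 => x _; exact: t0.
  near=> n; under eq_bigr => i _ do rewrite It.
  rewrite sumEFin lee_fin big_mkord.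
  apply: le_trans (_ : \sum_(i < n) A * r ^+ i <= _); last first.
    by rewrite -mulr_sumr; apply: ler_wpM2l => //; apply: sum_geom_le; rewrite r0.
  apply: ler_sum => i _.
  have -> : A * r ^+ i = (kap ^+ 2) ^- i * (A * q ^+ i).
    by rewrite /r; move: (kap ^+ 2) => y; rewrite exprMn exprVn mulrA mulrC.
  by apply: ler_wpM2l => //; exact: fA.
have iW : (@lebesgue_measure R).-integrable [set: R] W.
  apply/integrableP; split=> //.
  under eq_integral => x _ do rewrite gee0_abs//.
  by apply: le_lt_trans IW _; rewrite ltry.
have aeG := integrable_ae measurableT iW.
have loc x : W x \is a fin_num ->
    exists2 l : R, series (f ^~ x) @ \oo --> l & l ^+ 2 <= C2 * fine (W x).
  move=> Wfin; set w := fine (W x); have WE : W x = w%:E by rewrite fineK.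
  have w0 : 0 <= w by rewrite -lee_fin -WE.
  have bd n : `|f n x| <= Num.sqrt w * kap ^+ n.
    have : (t n x <= W x)%E.
      apply: le_trans (nneseries_lim_ge n.+1 (fun i _ _ => t0 i x)).
      by rewrite big_nat_recr//= leeDr// sume_ge0.
    rewrite WE lee_fin mulrC ler_pdivrMr ?exprn_gt0// -exprM mulnC exprM => H.
    rewrite -(@ler_pXn2r _ 2)// ?nnegrE ?mulr_ge0 ?sqrtr_ge0 ?exprn_ge0 ?(ltW k0)//.
    by rewrite real_normK ?num_real// exprMn sqr_sqrtr.
  have kk : 0 < kap < 1 by rewrite k0.
  have [l hl ll] := geom_dominated_cvg (sqrtr_ge0 w) kk bd.
  exists l => //; rewrite -real_normK ?num_real//.
  have -> : C2 * w = (Num.sqrt w / (1 - kap)) ^+ 2.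
    by rewrite exprMn sqr_sqrtr// mulrC.
  by apply: lerXn2r => //; rewrite nnegrE divr_ge0 ?sqrtr_ge0// subr_ge0 ltW.
pose G : set R := [set x | W x \is a fin_num].
have mG : measurable G.
  have -> : G = ~` (W @^-1` [set +oo%E]).
    by apply/seteqP; split=> x; rewrite /G /= ge0_fin_numE// ltey => /eqP.
  by apply: measurableC; rewrite -[_ @^-1` _]setTI; apply: mW => //; exact: emeasurable_set1.
pose g x := if pselect (W x \is a fin_num) is left H then projT1 (cid2 (loc x H)) else 0.
have gP x : W x \is a fin_num -> series (f ^~ x) @ \oo --> g x /\ g x ^+ 2 <= C2 * fine (W x).
  by move=> H; rewrite /g; case: pselect => // H'; case: cid2.
have mg : measurable_fun [set: R] g.
  apply: (@measurable_fun_cvg _ _ _ _ (fun n x => series (f ^~ x) n * \1_G x)).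
    move=> m; apply: measurable_funM; last exact: measurable_indic.
    rewrite /series /=; under eq_fun => x do rewrite big_mkord.
    by apply: measurable_sum => i; case: (hf i).
  move=> x _; rewrite indicE; have [xG|xG] := boolP (x \in G).
    under eq_fun do rewrite mulr1; rewrite inE in xG; exact: (gP x xG).1.
  under eq_fun do rewrite mulr0; rewrite /g; case: pselect => [H|_].
    by move: xG; rewrite notin_setE.
  exact: cvg_cst.
have aeg : {ae @lebesgue_measure R, forall x, [set: R] x -> ((g x ^+ 2)%:E <= C2%:E * W x)%E}.
  apply: filterS aeG => x /(_ I) H _; rewrite -[W x]fineK// lee_fin; exact: (gP x H).2.
have Ig : (\int[@lebesgue_measure R]_x (g x ^+ 2)%:E <= (C2 * C1 * A)%:E)%E.
  apply: le_trans (_ : \int[@lebesgue_measure R]_x (C2%:E * W x) <= _)%E.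
    apply: ae_ge0_le_integral => //.
    - by move=> x _; rewrite lee_fin sqr_ge0.
    - by apply/measurable_EFinP; exact: measurable_funX.
    - by move=> x _; rewrite mule_ge0.
    - exact: measurable_funeM.
  rewrite ge0_integralZl_EFin//.
  rewrite -mulrA [C1 * A]mulrC [X in (_ <= X)%E]EFinM.
  exact: lee_wpmul2l.
have hg : sq_integrable g.
  split=> //; apply/integrableP; split.
    by apply/measurable_EFinP; exact: measurable_funX.
  under eq_integral => x _ do rewrite gee0_abs ?lee_fin ?sqr_ge0//.
  by apply: le_lt_trans Ig _; rewrite ltry.
exists g; split=> //.
  rewrite ip_sqr /Rintegral -lee_fin fineK//; apply: integrable_fin_num => //.
  by case: hg.
by apply: filterS aeG => x /(_ I) H; exact: (gP x H).1.
Unshelve. all: by end_near. Qed.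

(** * Inversion of coercive hopping operators *)

Lemma hop_cvg (R : realType) (h : R) (V : R -> R) (s : nat -> R -> R) (g : R -> R) (x : R) :
  s ^~ (x + h) @ \oo --> g (x + h) -> s ^~ (x - h) @ \oo --> g (x - h) ->
  s ^~ x @ \oo --> g x -> (fun n => hop h V (s n) x) @ \oo --> hop h V g x.
Proof.
move=> h1 h2 h3; rewrite /hop; apply: cvgD; first exact: cvgD.
by apply: cvgM => //; exact: cvg_cst.
Qed.

Lemma hop_sum (R : realType) (h : R) (V : R -> R) (u : nat -> R -> R) (n : nat) (x : R) :
  hop h V (fun y => series (u ^~ y) n) x = series (fun i => hop h V (u i) x) n.
Proof.
rewrite /series /hop /= !big_mkord mulr_sumr -!big_split /=.
by apply: eq_bigr => i _.
Qed.

Lemma ip_eq0 (R : realType) (u : R -> R) : sq_integrable u -> ip u u = 0 ->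
  ae_eq (@lebesgue_measure R) [set: R] u (fun=> 0).
Proof.
move=> hu u0; have [m i2] := hu.
have m2 : measurable_fun [set: R] (fun x => (u x ^+ 2)%:E).
  by apply/measurable_EFinP; exact: measurable_funX.
have I0 : (\int[@lebesgue_measure R]_x `|(u x ^+ 2)%:E| = 0)%E.
  under eq_integral => x _ do rewrite gee0_abs ?lee_fin ?sqr_ge0//.
  rewrite -[LHS]fineK; last exact: integrable_fin_num.
  by rewrite -[fine _]/(Rintegral _ _ _) -ip_sqr u0.
have := (ae_eq_integral_abs (@lebesgue_measure R) measurableT m2).1 I0.
apply: filterS => x /(_ I) H _.
by move: H => /= [] /eqP; rewrite sqrf_eq0 => /eqP.
Qed.

Lemma ip_ae0 (R : realType) (u : R -> R) : sq_integrable u ->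
  ae_eq (@lebesgue_measure R) [set: R] u (fun=> 0) -> ip u u = 0.
Proof.
move=> [m _] u0.
have m2 : measurable_fun [set: R] (fun x => (u x ^+ 2)%:E).
  by apply/measurable_EFinP; exact: measurable_funX.
rewrite ip_sqr /Rintegral.
have -> : (\int[@lebesgue_measure R]_x (u x ^+ 2)%:E = \int[@lebesgue_measure R]_x cst 0%E x)%E.
  apply: ae_eq_integral => //.
  by apply: filterS u0 => x /(_ I) H _ /=; rewrite H expr0n.
by rewrite integral0.
Qed.

Section HopInverse.
Context (R : realType) (h : R) (V : R -> R) (b : R).
Hypotheses (mV : measurable_fun [set: R] V) (Vb : forall x, `|V x| <= b).
Local Notation mu := (@lebesgue_measure R).
Local Notation T := (hop h V).
Context (dl : R) (dl0 : 0 < dl).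
Hypothesis coer : forall u, sq_integrable u -> dl * ip u u <= ip (T u) (T u).

(** The inverse of a coercive self-adjoint bounded [T] is [T (T^2)^-1], where
    [T^2] is inverted by a Neumann series. *)
Lemma hop_solve : exists2 C : R, 0 <= C & forall f, sq_integrable f ->
  exists g, [/\ sq_integrable g, ip g g <= C * ip f f & ae_eq mu [set: R] (T g) f].
Proof.
(* [M] bounds the norm of [T^2] and exceeds [dl], so that [1 - T^2 / M] contracts *)
pose M := 3 * (2 + b ^+ 2) + dl.
have b0 : 0 <= 3 * (2 + b ^+ 2) by rewrite mulr_ge0// addr_ge0// sqr_ge0.
have M0 : 0 < M by exact: ltr_wpDl.
have M1 : 3 * (2 + b ^+ 2) + dl = M by [].
clearbody M.
pose q := 1 - dl / M.
have dlM : dl < M.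
  by rewrite -M1 ltrDr mulr_gt0// ltr_wpDr// sqr_ge0.
have q01 : 0 < q < 1.
  by rewrite /q gtrBl divr_gt0// subr_gt0 ltr_pdivrMr// mul1r dlM.
have [C C0 hC] := sq_series_cvg q01.
have M20 : 0 <= M ^- 2 by rewrite invr_ge0 exprn_ge0// ltW.
exists ((3 * (2 + b ^+ 2)) * (M ^- 2 * C)).
  by apply: mulr_ge0 => //; exact: mulr_ge0.
move=> f hf.
pose B (u : R -> R) (x : R) := u x - M^-1 * T (T u) x.
have hB u : sq_integrable u -> sq_integrable (B u).
  move=> hu; apply: sq_integrableB => //; apply: sq_integrableZ.
  by do 2 apply: (hop_sq_integrable h mV Vb).
have Bq u : sq_integrable u -> ip (B u) (B u) <= q * ip u u.
  move=> hu; have hTu := hop_sq_integrable h mV Vb hu.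
  have hTTu := hop_sq_integrable h mV Vb hTu.
  have hk := sq_integrableZ M^-1 hTTu.
  rewrite /B ipBl//; last exact: hB.
  rewrite [ip u _]ipC ipBl// [ip _ (fun x => u x - _)]ipC ipBl//.
  rewrite [ip u (fun x => M^-1 * _)]ipC !(@ipZl _ M^-1)//.
  rewrite [ip (T (T u)) (fun x => M^-1 * _)]ipC (@ipZl _ M^-1)//.
  rewrite (@hop_sym _ h V b mV Vb (T u) u)//.
  set s := ip (T u) (T u); set t := ip (T (T u)) (T (T u)).
  have st : t <= M * s.
    apply: le_trans (hop_bound h mV Vb hTu) _; apply: ler_wpM2r; first exact: ip_ge0.
    by rewrite -M1 lerDl ltW.
  have ds : dl * ip u u <= s := coer hu.
  have -> : ip u u - M^-1 * s - (M^-1 * s - M^-1 * (M^-1 * t)) =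
    ip u u - 2 * (M^-1 * s) + M^-1 * (M^-1 * t) by ring.
  have h1 : M^-1 * (M^-1 * t) <= M^-1 * s.
    rewrite ler_pM2l ?invr_gt0// mulrC ler_pdivrMr// mulrC; exact: st.
  have h2 : M^-1 * (dl * ip u u) <= M^-1 * s by rewrite ler_pM2l ?invr_gt0.
  have -> : q * ip u u = ip u u - M^-1 * (dl * ip u u) by rewrite /q; ring.
  lra.
pose u n := iter n B f.
have hu n : sq_integrable (u n) by elim: n => [|n IH] //=; exact: hB.
have uq n : ip (u n) (u n) <= ip f f * q ^+ n.
  elim: n => [|n IH]; first by rewrite expr0 mulr1.
  apply: le_trans (Bq _ (hu n)) _; rewrite exprS mulrCA ler_wpM2l//.
  by case/andP: q01 => /ltW.
have [g [hg gC gae]] := hC u (ip f f) (ip_ge0 f) hu uq.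
have hTg := hop_sq_integrable h mV Vb hg.
exists (fun x => M^-1 * T g x); split.
- exact: sq_integrableZ.
- rewrite ipZl//; last exact: sq_integrableZ.
  rewrite ipC ipZl// mulrA -expr2 exprVn.
  apply: le_trans (_ : M ^- 2 * (3 * (2 + b ^+ 2) * (C * ip f f)) <= _).
    apply: ler_wpM2l => //.
    apply: le_trans (hop_bound h mV Vb hg) _; exact: ler_wpM2l.
  by rewrite le_eqVlt; apply/orP; left; apply/eqP; ring.
have telescope n x : hop h V (hop h V (fun y => series (u ^~ y) n)) x = M * (f x - u n x).
  have -> : hop h V (fun y => series (u ^~ y) n) =
     (fun y => series (fun i => hop h V (u i) y) n).
    by apply/funext => y; rewrite hop_sum.
  rewrite (hop_sum h V (fun i => T (u i))) /series /= big_mkord.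
  elim: n => [|n IH]; first by rewrite big_ord0 subrr mulr0.
  rewrite big_ord_recr /= IH /B; field; exact: lt0r_neq0.
have g1 : {ae mu, forall x, (fun n => T (fun y => series (u ^~ y) n) x) @ \oo --> T g x}.
  have := gae; have := ae_shift (- h) gae; have := ae_shift h gae.
  by apply: (@filterS3 _ _ (ae_filter_ringOfSetsType mu)) => x; exact: hop_cvg.
have g2 : {ae mu, forall x, (fun n => T (T (fun y => series (u ^~ y) n)) x) @ \oo --> T (T g) x}.
  have := g1; have := ae_shift (- h) g1; have := ae_shift h g1.
  by apply: (@filterS3 _ _ (ae_filter_ringOfSetsType mu)) => x; exact: hop_cvg.
have := gae; have := g2; apply: (@filterS2 _ _ (ae_filter_ringOfSetsType mu)) => x {}g2 gx _.
have u0 : u ^~ x @ \oo --> 0 by apply: cvg_series_cvg_0; apply: cvgP gx.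
have lim : (fun n => M * (f x - u n x)) @ \oo --> M * (f x - 0).
  apply: cvgM; first exact: cvg_cst.
  by apply: cvgB => //; exact: cvg_cst.
have E : T (T g) x = M * f x.
  have : (fun n => M * (f x - u n x)) @ \oo --> T (T g) x.
    by move: g2; under eq_fun do rewrite telescope.
  by move=> /(cvg_unique (@Rhausdorff R)) /(_ lim); rewrite subr0.
have -> : T (fun x => M^-1 * T g x) x = M^-1 * T (T g) x by rewrite /hop; ring.
by rewrite E mulKf// gt_eqF.
Qed.

(** This makes the right inverse given by [hop_solve] a two-sided one. *)
Lemma hop_inj g f : sq_integrable g -> sq_integrable f ->
  ae_eq mu [set: R] (T g) (T f) -> ae_eq mu [set: R] g f.
Proof.
move=> hg hf gf; pose w x := g x - f x.
have hw : sq_integrable w by exact: sq_integrableB.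
have w0 : ip (T w) (T w) = 0.
  apply: ip_ae0; first exact: (hop_sq_integrable h mV Vb).
  apply: filterS gf => x /(_ I) H _.
  have -> : T w x = T g x - T f x by rewrite /hop /w; ring.
  by rewrite H subrr.
have ww : ip w w = 0.
  apply/eqP; rewrite eq_le ip_ge0 andbT.
  by have := coer hw; rewrite w0 pmulr_rle0.
by have := ip_eq0 hw ww; apply: filterS => x /(_ I) /eqP; rewrite subr_eq0 => /eqP.
Qed.

End HopInverse.

(** * The resolvent of the Harper operator *)

Local Open Scope complex_scope.

Lemma L2_components (R : realType) (psi : R -> R[i]) :
  L2 psi <-> sq_integrable (fun x => complex.Re (psi x)) /\
             sq_integrable (fun x => complex.Im (psi x)).
Proof. by split=> -[h1 h2]; split; apply/sq_integrable_Lfun. Qed.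

Lemma L2normE (R : realType) (psi : R -> R[i]) : L2 psi ->
  L2norm psi = (Num.sqrt (ip (fun x => complex.Re (psi x)) (fun x => complex.Re (psi x))
    + ip (fun x => complex.Im (psi x)) (fun x => complex.Im (psi x))))%:E.
Proof.
move=> /L2_components[hr hi]; have [_ ir] := hr; have [_ ii] := hi.
rewrite /L2norm unlock /Lnorm.
have -> : (\int[@lebesgue_measure R]_x
    (`|(complex.ComplexField.Normc.normc (psi x))%:E| `^ 2) =
    \int[@lebesgue_measure R]_x ((complex.Re (psi x) ^+ 2)%:E + (complex.Im (psi x) ^+ 2)%:E))%E.
  apply: eq_integral => x _; rewrite /= powR_mulrn// real_normK ?num_real//.
  case: (psi x) => a c /=; rewrite sqr_sqrtr ?addr_ge0 ?sqr_ge0//.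
rewrite integralD// !ip_sqr /Rintegral -powR12_sqrt.
  rewrite -poweR_EFin EFinD !fineK//; exact: integrable_fin_num.
by rewrite addr_ge0// fine_ge0// integral_ge0// => x _; rewrite lee_fin sqr_ge0.
Qed.

Lemma measurable_harper_pot (R : realType) (lam E : R) :
  measurable_fun [set: R] (fun x : R => 2 * lam * cos (2 * pi * x) - E).
Proof.
apply: continuous_measurable_fun => x; apply: cvgB; last exact: cvg_cst.
apply: cvgM; first exact: cvg_cst.
apply: continuous_comp; last exact: continuous_cos.
by apply: cvgM; [exact: cvg_cst|exact: cvg_id].
Qed.

Lemma harper_pot_le (R : realType) (lam E x : R) :
  `|2 * lam * cos (2 * pi * x) - E| <= 2 * `|lam| + `|E|.
Proof.
apply: le_trans (ler_normB _ _) _; rewrite lerD2r !normrM ger0_norm//.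
by rewrite ler_piMr ?mulr_ge0// cos_max.
Qed.

(** The operator has real coefficients, so the real and the imaginary part are
    solved for separately. *)
Lemma resolvent_of_coercive (R : realType) (h lam E dl : R) : 0 < dl ->
  (forall u, sq_integrable u ->
     dl * ip u u <= ip (hop h (fun x => 2 * lam * cos (2 * pi * x) - E) u)
                       (hop h (fun x => 2 * lam * cos (2 * pi * x) - E) u)) ->
  resolvent_set (harper h lam) E%:C.
Proof.
move=> dl0; set V := fun x => _ => coer.
pose b := 2 * `|lam| + `|E|.
have mV : measurable_fun [set: R] V := measurable_harper_pot lam E.
have Vb x : `|V x| <= b := harper_pot_le lam E x.
have [C C0 hC] := hop_solve mV Vb dl0 coer.
pose sol f : R -> R := if pselect (sq_integrable f) is left H then projT1 (cid (hC f H)) else f.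
have solP f : sq_integrable f -> [/\ sq_integrable (sol f),
    ip (sol f) (sol f) <= C * ip f f & ae_eq (@lebesgue_measure R) setT (hop h V (sol f)) f].
  by move=> H; rewrite /sol; case: pselect => // H'; case: cid.
pose re (psi : R -> R[i]) x := complex.Re (psi x).
pose im (psi : R -> R[i]) x := complex.Im (psi x).
have harRe psi x : complex.Re (harper h lam psi x - E%:C * psi x) = hop h V (re psi) x.
  rewrite /harper /hop /V /re; case: (psi x) => a c; case: (psi (x + h)) => a' c'.
  by case: (psi (x - h)) => a'' c'' /=; ring.
have harIm psi x : complex.Im (harper h lam psi x - E%:C * psi x) = hop h V (im psi) x.
  rewrite /harper /hop /V /im; case: (psi x) => a c; case: (psi (x + h)) => a' c'.
  by case: (psi (x - h)) => a'' c'' /=; ring.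
pose S (psi : R -> R[i]) (x : R) : R[i] := Complex (sol (re psi) x) (sol (im psi) x).
have LS f : L2 f -> L2 (S f).
  move=> /L2_components[hr hi]; apply/L2_components; split.
    by have [] := solP _ hr.
  by have [] := solP _ hi.
exists S; split.
- exact: LS.
- exists (Num.sqrt C) => f Lf; rewrite (L2normE (LS f Lf)) (L2normE Lf).
  have [hr hi] := (L2_components f).1 Lf.
  have [_ sr _] := solP _ hr; have [_ si _] := solP _ hi.
  rewrite -EFinM lee_fin -sqrtrM//; apply: ler_wsqrtr.
  by rewrite mulrDr; exact: lerD.
- move=> f /L2_components[hr hi].
  have [_ _ sr] := solP _ hr; have [_ _ si] := solP _ hi.
  rewrite /L2eq /ae_eq; have := si; have := sr.
  apply: (@filterS2 _ _ (ae_filter_ringOfSetsType lebesgue_measure)) => x.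
  move=> /(_ I) e1 /(_ I) e2 _; apply/eqP; rewrite eq_complex harRe harIm.
  by rewrite -[re (S f)]/(sol (re f)) -[im (S f)]/(sol (im f)) e1 e2 !eqxx.
- move=> f /L2_components[hr hi].
  have -> : S (fun x => harper h lam f x - E%:C * f x) =
      (fun x => Complex (sol (hop h V (re f)) x) (sol (hop h V (im f)) x)).
    apply/funext => x; rewrite /S; congr (Complex (sol _ _) (sol _ _)).
      by apply/funext => y; rewrite -harRe.
    by apply/funext => y; rewrite -harIm.
  have inv u : sq_integrable u -> ae_eq (@lebesgue_measure R) setT (sol (hop h V u)) u.
    move=> hu; have hTu := hop_sq_integrable h mV Vb hu.
    have [s1 _ s3] := solP _ hTu.
    exact: (hop_inj mV Vb dl0 coer s1 hu s3).
  rewrite /L2eq /ae_eq; have := inv _ hi; have := inv _ hr.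
  apply: (@filterS2 _ _ (ae_filter_ringOfSetsType lebesgue_measure)) => x.
  move=> /(_ I) e1 /(_ I) e2 _; apply/eqP; rewrite eq_complex /=.
  by rewrite e1 e2 !eqxx.
Qed.

(** * Existence of the gaps *)

Lemma gap_resolvent (R : realType) (h lam z : R) (k : nat) (E0 E : R) :
  small_coupling h lam z k -> eff_diag h lam k E0 0 = 0 ->
  `|E0 - res_energy h k| <= z ^+ 13 -> `|E - E0| < half_gap h lam k / 2 ->
  resolvent_set (harper h lam) E%:C.
Proof.
move=> Sc c0 near EE; have [d d0 fc] := dual_coercive Sc c0 near EE.
have fc' := space_coercive fc.
apply: (@resolvent_of_coercive R h lam E (d / 3 / 3)); first by rewrite !divr_gt0.
apply: (hop_coercive (measurable_harper_pot lam E) (harper_pot_le lam E)) => x.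
have := fc' x; congr (fin_coercive 1 _ _); apply/funext => n.
by congr (_ * cos _ - _); rewrite mulrCA mulrA.
Qed.

(** The open interval of length [half_gap] is connected, hence contained in the
    component of its center. *)
Lemma in_large_gap_interval (R : realType) (C h lam b E0 : R) (k : nat) :
  0 < half_gap h lam k ->
  (forall E, `|E - E0| < half_gap h lam k / 2 -> resolvent_set (harper h lam) E%:C) ->
  in_large_gap C h lam b k E0.
Proof.
move=> t0 res; set t := half_gap h lam k in t0 res.
pose A := [set E : R | ~ spectrum (harper h lam) E%:C].
have AE E : `|E - E0| < t / 2 -> A E by move=> /res rE; apply.
have AE0 : A E0 by apply: AE; rewrite subrr normr0 divr_gt0.
pose I := `](E0 - t / 2), (E0 + t / 2)[%classic.
have IA : I `<=` connected_component A E0.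
  apply: connected_component_max.
  - by rewrite /I /mkset /= ?in_itv /=; apply/andP; split; lra.
  - move=> E; rewrite /I /mkset /= ?in_itv /= => /andP[h1 h2].
    by apply: AE; rewrite ltr_norml; apply/andP; split; lra.
  - by apply/connected_intervalP; exact: interval_is_interval.
exists (connected_component A E0); split.
- by exists E0.
- exact: connected_component_refl.
- exists 0; split; first by rewrite /OH normr0 mulr_ge0// expR_ge0.
  have -> : 4 * (lam / 4) ^+ k * ((1 + 0) / sin2_prod h k) = t.
    by rewrite addr0 div1r.
  have -> : t%:E = @lebesgue_measure R I.
    rewrite /I lebesgue_measure_itv /= lte_fin ifT; last lra.
    by rewrite -EFinB; congr _%:E; field.
  apply: le_measure => //; rewrite inE.
    exact: measurable_itv.
  apply: is_interval_measurable; apply/connected_intervalP.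
  exact: component_connected.
Qed.

Lemma small_couplingI (R : realType) (h lam : R) (k : nat) : 0 < h < 1 / 2 -> (0 < k)%N ->
  0 < 1 - 2 * h * k%:R -> 0 < lam ->
  lam <= (expR (- h^-1) * (1 - 2 * h * k%:R)) ^+ 20 ->
  small_coupling h lam (expR (- h^-1) * (1 - 2 * h * k%:R)) k.
Proof.
move=> /andP[h0 h12] k0 y0 l0 lz; set y := 1 - _ in y0 lz *.
set x := expR (- h^-1) in lz *.
have hk : 0 <= 2 * h * k%:R by rewrite !mulr_ge0// ltW.
have y1 : y <= 1 by rewrite /y; lra.
have x0 : 0 < x by exact: expR_gt0.
have zx : x * y <= x by rewrite ler_piMr// ltW.
have hV : 2 <= h^-1.
  rewrite -[2]invrK lef_pV2 ?posrE ?invr_gt0//; lra.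
have x14 : x <= 1 / 4.
  apply: le_trans (_ : expR (- 2) <= _); first by rewrite ler_expR lerN2.
  rewrite expRN div1r lef_pV2 ?posrE ?expR_gt0//.
  have -> : expR 2 = expR 1 ^+ 2 :> R by rewrite -expRM_natr mul1r.
  have -> : 4 = 2 ^+ 2 :> R by rewrite -natrX.
  by apply: lerXn2r; rewrite ?nnegrE ?expR_ge0 ?expR1_ge2.
have x1 : x <= 1 by lra.
have xh : x <= h.
  by rewrite /x expRN -[leRHS]invrK lef_pV2 ?posrE ?expR_gt0 ?invr_gt0// expR_ge_id.
have x4k : x * 4 ^+ k <= 1.
  rewrite /x expRN mulrC ler_pdivrMr ?expR_gt0// mul1r.
  have -> : 4 = 2 ^+ 2 :> R by rewrite -natrX.
  rewrite -exprM; apply: le_trans (_ : expR 1 ^+ (2 * k) <= _).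
    by apply: lerXn2r; rewrite ?nnegrE ?expR_ge0 ?expR1_ge2.
  rewrite -expRM_natr mul1r ler_expR -[leRHS]mul1r ler_pdivlMr// natrM.
  by move: y0; rewrite /y; lra.
have k4 : 4 * k%:R <= 4 ^+ k :> R.
  rewrite -natrX -natrM ler_nat; clear -k0; elim: k k0 => // -[|k] IH _ //.
  by rewrite expnS mulnS; have := IH isT; lia.
split=> //.
- exact: mulr_gt0.
- exact: le_trans zx x14.
- exact: le_trans zx xh.
- by rewrite ler_piMl// ltW.
- apply: le_trans x4k; apply: ler_wpM2r => //; exact: exprn_ge0.
- have : x * y * (4 * k%:R) <= 1.
    by apply: le_trans x4k; apply: ler_pM => //; rewrite mulr_ge0// ltW.
  lra.
- move=> n; apply: le_trans zx _.
  have -> : x = expR (- (1 / (2 * h))) ^+ 2.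
    by rewrite -expRM_natr; congr expR; field; rewrite gt_eqF.
  apply: lerXn2r; rewrite ?nnegrE ?expR_ge0 ?prod_lin_ge//.
  by apply: prodr_ge0 => i _; rewrite !mulr_ge0// ltW.
Qed.

(** The relative error in the length of the gap is zero, so the bound holds for
    every exponent [b], and with it for both exponents in the theorem. *)
Lemma gap_existence (R : realType) (C h lam : R) (k : nat) :
  0 < h < 1 / 2 -> (0 < k)%N -> 0 < 1 - 2 * h * k%:R -> 0 < lam ->
  lam <= (expR (- h^-1) * (1 - 2 * h * k%:R)) ^+ 20 ->
  exists r : R, [/\ h * `|r| <= 2 * lam, 0 < 2 * cos (pi * h * k%:R + r) &
    forall b : R, in_large_gap C h lam b k (2 * cos (pi * h * k%:R + r))].
Proof.
move=> hh k0 y0 l0 lz; have Sc := small_couplingI hh k0 y0 l0 lz.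
move/andP: hh => [h0 h12].
set z := expR (- h^-1) * _ in lz Sc.
have [r rl [rz fr]] := gap_center Sc.
have z0 := sc_z0 Sc; have z14 : z <= 1 / 4 := sc_z4 Sc.
have zh := sc_zh Sc; have zy := sc_zy Sc.
have small : 2 * (z * `|r|) <= z ^+ 20.
  apply: le_trans (sc_lz Sc); apply: le_trans rl.
  by rewrite -mulrA ler_pM2l// ler_wpM2r.
have {}small : 2 * `|r| <= z ^+ 19.
  by rewrite -(ler_pM2r z0) -exprSr; move: small; lra.
have zpow m n : z ^+ (m + n) <= z ^+ m / 4 ^+ n.
  rewrite exprD; apply: ler_wpM2l; first by rewrite exprn_ge0// ltW.
  by rewrite -exprVn; apply: lerXn2r; rewrite ?nnegrE; lra.
have near : `|2 * cos (pi * (h * k%:R + r)) - res_energy h k| <= z ^+ 13.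
  rewrite /res_energy -mulrBr normrM ger0_norm//.
  have := cos_lip (pi * (h * k%:R + r)) (pi * (h * k%:R)).
  rewrite -mulrBr [h * _ + r]addrC addrK normrM [`|pi|]ger0_norm ?pi_ge0//.
  have h1 : z ^+ 19 <= z ^+ 13 / 4 ^+ 6 := zpow 13 6.
  have h2 := ler_wpM2r (normr_ge0 r) (@pi_le4 R).
  have : 0 < z ^+ 13 by rewrite exprn_gt0.
  lra.
have E0E : pi * h * k%:R + pi * r = pi * (h * k%:R + r) by ring.
exists (pi * r); rewrite E0E; split.
- rewrite normrM ger0_norm ?pi_ge0// mulrCA.
  have := ler_wpM2r (mulr_ge0 (ltW h0) (normr_ge0 r)) (@pi_le4 R); lra.
- rewrite mulr_gt0// cos_gt0_pihalf//.
  have rz1 : `|r| <= z / 4.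
    have : z ^+ 19 <= z ^+ 1 / 4 ^+ 18 := zpow 1 18.
    by rewrite expr1; lra.
  move: rz1; rewrite ler_norml => /andP[r1 r2].
  have hk : h <= h * k%:R by rewrite ler_peMr ?ler1n// ltW.
  have p0 := @pi_gt0 R; apply/andP; split.
    by apply: lt_trans (_ : 0 < _); [lra|rewrite mulr_gt0//; lra].
  by rewrite ltr_pM2l//; lra.
- move=> b; apply: in_large_gap_interval.
    exact: (half_gap_gt0 Sc).
  by move=> E; exact: (gap_resolvent Sc fr near).
Qed.

(** * Ranges of the coupling constant *)

(** A value for [E_K] when nothing is known about the gap number [K]: the point
    [2 cos (pi h K)] may be zero, and a shift of the phase makes it positive. *)
Lemma fallback_energy (R : realType) (h w : R) (k : nat) : 0 < h -> (0 < k)%N ->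
  2 * h * k%:R <= 1 -> 0 < w <= 1 -> 0 < 2 * cos (pi * h * k%:R + - w).
Proof.
move=> h0 k0 hk /andP[w0 w1]; rewrite mulr_gt0// cos_gt0_pihalf//.
have p0 := @pi_gt0 R; have p1 := @pihalf_ge1 R.
have a0 : 0 < pi * h * k%:R by rewrite !mulr_gt0// ltr0n.
have a1 : pi * h * k%:R <= pi / 2.
  by rewrite -mulrA ler_pM2l//; lra.
apply/andP; split; lra.
Qed.

(** Here [y = 1 - 2 h K] has no lower bound in terms of [h].  Taking the power [1/h1] in
    the hypothesis on [lam^h1] gives [lam <= exp (- 40 / y)], and the geometric
    mean with [lam <= exp (- 40 / h)] is of the required form. *)
Lemma even_small (R : realType) (h lam y h1 : R) : 0 < h < 1 / 2 -> 0 <= h1 -> y = h * h1 ->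
  0 < lam <= expR (- 40 / h) -> lam `^ h1 <= expR (- 40 / h) ->
  0 < y /\ lam <= (expR (- h^-1) * y) ^+ 20.
Proof.
move=> /andP[h0 h12] h10 yE /andP[l0 l1] l2.
have hV : 0 < h^-1 by rewrite invr_gt0.
have h1n : h1 != 0.
  apply/eqP => h1E; move: l2; rewrite h1E powRr0 leNgt => /negP; apply.
  by rewrite expR_lt1 mulNr oppr_lt0 divr_gt0.
have {}h10 : 0 < h1 by rewrite lt_neqAle eq_sym h1n.
have y0 : 0 < y by rewrite yE mulr_gt0.
have ly : lam <= expR (- 40 / y).
  rewrite leNgt; apply/negP => H; move: l2; rewrite leNgt => /negP; apply.
  have -> : - 40 / h = - 40 / y * h1.
    by rewrite yE; field; rewrite h1n gt_eqF.
  by rewrite expRM; apply: gt0_ltr_powR => //; rewrite nnegrE ?expR_ge0// ltW.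
split=> //.
have ey : expR (- y^-1) <= y.
  by rewrite expRN -[leRHS]invrK lef_pV2 ?posrE ?expR_gt0 ?invr_gt0// expR_ge_id.
have e0 : 0 <= expR (- h^-1) * y by rewrite mulr_ge0 ?expR_ge0// ltW.
rewrite -(@ler_pXn2r _ 2)// ?nnegrE ?exprn_ge0 ?(ltW l0)//.
apply: le_trans (_ : expR (- 40 / h) * expR (- 40 / y) <= _).
  by rewrite expr2; apply: ler_pM => //; exact: ltW.
have -> : expR (- 40 / h) * expR (- 40 / y) = (expR (- h^-1) * expR (- y^-1)) ^+ 40.
  by rewrite -expRD -expRD -expRM_natr; congr expR; ring.
rewrite -exprM; apply: lerXn2r; rewrite ?nnegrE ?mulr_ge0 ?expR_ge0//.
  exact: ltW.
by rewrite ler_wpM2l ?expR_ge0.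
Qed.

Lemma wide_small (R : realType) (h lam y : R) : 0 < h -> h <= y ->
  lam <= expR (- 40 / h) -> lam <= (expR (- h^-1) * y) ^+ 20.
Proof.
move=> h0 hy l1; apply: le_trans l1 _.
have -> : expR (- 40 / h) = (expR (- h^-1) * expR (- h^-1)) ^+ 20.
  by rewrite -expRD -expRM_natr; congr expR; ring.
have eh : expR (- h^-1) <= h.
  by rewrite expRN -[leRHS]invrK lef_pV2 ?posrE ?expR_gt0 ?invr_gt0// expR_ge_id.
apply: lerXn2r; rewrite ?nnegrE ?mulr_ge0 ?expR_ge0//; first exact/ltW/(lt_le_trans h0).
by rewrite ler_wpM2l ?expR_ge0// (le_trans eh).
Qed.

Local Close Scope complex_scope.
Local Close Scope classical_set_scope.

(** * The gaps of the Harper operator *)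

Unset Implicit Arguments.
Set Strict Implicit.

Theorem theorem2p5 (R : realType) (beta : R) (hbeta : 0 < beta < 1 / 2) :
  exists c0 C : R, [/\ 0 < c0, 0 < C &
    forall c : R, c0 <= c ->
    forall h lambda : R, 0 < h < 1 / 2 -> 0 < lambda <= expR (- c / h) ->
    let K := Num.truncn (1 / (2 * h)) in
    let N := Num.truncn (1 / h) in
    let h1 := 1 / h - N%:R in
    exists E : nat -> R,
      [/\ forall k : nat, (1 <= k <= K)%N ->
            0 < E k /\
            exists r : R, OH C h r (lambda `^ beta) /\
                          E k = 2 * cos (pi * h * k%:R + r),
          forall k : nat, (1 <= k <= K - 1)%N \/ (k = K /\ odd N) ->
            in_large_gap C h lambda beta k (E k)
        & ~~ odd N -> lambda `^ h1 <= expR (- c / h) ->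
            in_large_gap C h lambda (Num.min h1 beta) K (E K)]].
Proof.
(* [40] is twice the exponent of [z] in [small_coupling], since [z] is at least
   [exp (- 2 / h)] as soon as [1 - 2 h k >= h]. *)
exists 40, 2; split => // c c40 h lam hh /andP[l0 lc] K N h1.
have [h0 h12] := andP hh.
have b0 : 0 < beta by case/andP: hbeta.
have cle : expR (- c / h) <= expR (- 40 / h).
  by rewrite ler_expR ler_pM2r ?invr_gt0// lerN2.
have lc40 : lam <= expR (- 40 / h) := le_trans lc cle.
have l1 : lam <= 1.
  by apply: le_trans lc40 _; rewrite expR_le1 mulNr oppr_le0 divr_ge0// ltW.
have lb1 : lam <= lam `^ beta.
  by rewrite -{1}[lam]powRr1 ?(ltW l0)// ger_powR ?l0//; case/andP: hbeta; lra.
have lb0 : 0 < lam `^ beta by exact: powR_gt0.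
have lb_le1 : lam `^ beta <= 1.
  have := @ger_powR _ lam; rewrite l0 l1 => /(_ isT 0 beta (ltW b0)).
  by rewrite powRr0.
have e1 : 1 <= expR (2 / h) by apply: ltW; rewrite expR_gt1 divr_gt0.
have h2V : 0 <= 1 / (2 * h) by rewrite divr_ge0// mulr_ge0// ltW.
have hV : 0 <= 1 / h by rewrite divr_ge0// ltW.
have [K1 K2] := andP (truncn_itv h2V).
have [N1 N2] := andP (truncn_itv hV).
rewrite -/K in K1 K2; rewrite -/N in N1 N2.
have {}K1 : 2 * h * K%:R <= 1.
  by move: K1; rewrite ler_pdivlMr ?mulr_gt0// mulrC.
have {}K2 : 1 < 2 * h * K.+1%:R.
  by move: K2; rewrite ltr_pdivrMr ?mulr_gt0// mulrC.
have {}N1 : h * N%:R <= 1 by move: N1; rewrite ler_pdivlMr// mulrC.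
have {}N2 : 1 < h * N.+1%:R by move: N2; rewrite ltr_pdivrMr// mulrC.
have K0 : (0 < K)%N.
  rewrite lt0n; apply/eqP => K0; move: K2; rewrite K0; lra.
have KN : (2 * K <= N)%N.
  rewrite -ltnS -(ltr_nat R) -(ltr_pM2l h0); apply: le_lt_trans N2.
  by rewrite natrM; move: K1; lra.
have NK : (N <= (2 * K).+1)%N.
  rewrite -ltnS -(ltr_nat R) -(ltr_pM2l h0); apply: le_lt_trans N1 _.
  by rewrite -[(2 * K).+2]addn2 natrD natrM; move: K2; rewrite -[K.+1%:R]natr1; lra.
pose y (k : nat) := 1 - 2 * h * k%:R.
pose good (k : nat) := 0 < y k /\ lam <= (expR (- h^-1) * y k) ^+ 20.
have goodP k : (1 <= k <= K)%N -> good k -> exists E : R,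
    [/\ 0 < E, exists r : R, OH 2 h r (lam `^ beta) /\ E = 2 * cos (pi * h * k%:R + r)
      & forall b, in_large_gap 2 h lam b k E].
  move=> /andP[k0 kK] [yk lk].
  have [r [hr E0 gap]] := gap_existence 2 hh k0 yk l0 lk.
  exists (2 * cos (pi * h * k%:R + r)); split=> //; exists r; split=> //.
  rewrite /OH [`|lam `^ _|]gtr0_norm// -(ler_pM2l h0); apply: le_trans hr _.
  (* [2 <= exp (1 / h)] and [1 <= h exp (1 / h)] absorb the constants *)
  have eV : 1 <= h * expR h^-1 by rewrite -ler_pdivrMl// mulr1 expR_ge_id.
  have e2 : 2 <= expR h^-1.
    apply: le_trans (expR1_ge2 R) _; rewrite ler_expR -[leLHS]invr1 lef_pV2 ?posrE//; lra.
  have -> : expR (2 / h) = expR h^-1 * expR h^-1.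
    by rewrite -expRD; congr expR; ring.
  apply: le_trans (_ : 2 * lam `^ beta <= _); first by rewrite ler_pM2l.
  rewrite !mulrA; apply: ler_wpM2r; first exact: ltW.
  apply: le_trans e2 _; apply: ler_peMl => //; exact: expR_ge0.
have goodE k : exists E : R,
  [/\ (1 <= k <= K)%N -> 0 < E /\
        exists r : R, OH 2 h r (lam `^ beta) /\ E = 2 * cos (pi * h * k%:R + r)
    & (1 <= k <= K)%N -> good k -> forall b, in_large_gap 2 h lam b k E].
  case: (boolP (1 <= k <= K)%N) => [kK|_]; last by exists 0; split.
  case: (pselect (good k)) => [gk|ngk].
    by have [E [E0 Er Eg]] := goodP k kK gk; exists E; split.
  exists (2 * cos (pi * h * k%:R + - lam `^ beta)); split=> // _.
  have [k0 kK'] := andP kK.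
  split; last first.
    exists (- lam `^ beta); split=> //.
    by rewrite /OH normrN gtr0_norm//; apply: ler_peMl => //; exact: ltW.
  apply: fallback_energy => //; last by rewrite lb0.
  apply: le_trans K1; rewrite ler_pM2l ?mulr_gt0// ler_nat //.
have [E EP] := choice goodE.
exists E; split.
- by move=> k kK; have [h_ _] := EP k; exact: h_.
- move=> k kcase; have [_ gk] := EP k.
  have [kK hy] : (1 <= k <= K)%N /\ h <= y k.
    case: kcase => [/andP[k0 kK]|[-> oN]].
      split; first by rewrite k0 (leq_trans kK)// leq_subr.
      have : k.+1%:R <= K%:R :> R by rewrite ler_nat; move: kK k0 K0; clear; lia.
      rewrite -natr1 -(ler_pM2l h0) /y; move: K1; lra.
    split; first by rewrite K0 leqnn.
    have NE : N = (2 * K).+1.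
      apply/eqP; rewrite eqn_leq NK ltn_neqAle KN andbT.
      by apply: contraTneq oN => <-; rewrite oddM.
    by move: N1; rewrite NE -natr1 natrM /y; lra.
  apply: gk => //; split; first exact: lt_le_trans h0 hy.
  exact: wide_small.
- move=> eN lh1; have [_ gK] := EP K.
  apply: gK; first by rewrite K0 leqnn.
  have NE : N = (2 * K)%N.
    have : N != (2 * K).+1 by apply: contraNneq eN => ->; rewrite /= oddM.
    by move: NK KN; clear; lia.
  apply: (@even_small R h lam (y K) h1) => //.
  + rewrite /h1 subr_ge0 ler_pdivlMr// mulrC; exact: N1.
  + by rewrite /h1 NE natrM /y; field; rewrite gt_eqF.
  + by rewrite l0.
  + exact: le_trans lh1 cle.
Qed.
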